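(* Let $\zeta$ be an extremal number. Then \[ \lambda_{4}(\zeta)\ge \frac{\sqrt5-1}{4}. \] If moreover $w_4(\zeta)=w_2(\zeta)=2+\sqrt5$, then $\lambda_4(\zeta)=\frac{\sqrt5-1}{4}$ and \[ \widehat{w}_{4}(\zeta)=4, \qquad \widehat{\lambda}_{4}(\zeta)=\frac14. \]
   Context: For $P(T)=a_nT^n+\cdots+a_0\in\mathbb{Z}[T]$ let $H(P)=\max_j|a_j|$. For a real number $\zeta$ and an integer $n\ge1$: - $w_n(\zeta)$ (resp. $\widehat{w}_n(\zeta)$) is the supremum of $\eta\in\mathbb{R}$ such that the system $H(P)\le X$, $0<|P(\zeta)|\le X^{-\eta}$ has a solution $P\in\mathbb{Z}[T]$ of degree at most $n$ for arbitrarily large $X$ (resp. for all sufficiently large $X$). - $\lambda_n(\zeta)$ (resp. $\widehat{\lambda}_n(\zeta)$) is the supremum of $\eta\in\mathbb{R}$ such that the system $0<|x|\le X$, $\max_{1\le i\le n}|\zeta^i x-y_i|\le X^{-\eta}$ has a solution $(x,y_1,\dots,y_n)\in\mathbb{Z}^{n+1}$ for arbitrarily large $X$ (resp. for all sufficiently large $X$). A real transcendental number $\zeta$ is called an extremal number if $\widehat{w}_2(\zeta)=(3+\sqrt5)/2$ (the maximal possible value for transcendental reals). For extremal numbers it is known that $w_2(\zeta)=2+\sqrt5$. *)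

(* Defs.v *)
From mathcomp Require Import all_boot all_order all_algebra.
From mathcomp Require Import all_classical all_reals all_analysis.

Set Implicit Arguments.
Unset Strict Implicit.
Unset Printing Implicit Defensive.

Import Order.TTheory GRing.Theory Num.Theory.

Local Open Scope classical_set_scope.
Local Open Scope ring_scope.

Definition arbitrarily_large (R : realType) (S : R -> Prop) : Prop :=
  forall X0 : R, exists X : R, X0 <= X /\ S X.

Definition sufficiently_large (R : realType) (S : R -> Prop) : Prop :=
  exists X0 : R, forall X : R, X0 <= X -> S X.

Definition height (P : {poly int}) : nat := (\max_(i < size P) absz (P`_i)%R)%N.

Definition ieval (R : realType) (P : {poly int}) (zeta : R) : R :=
  (map_poly intr P).[zeta].

Definition poly_system (R : realType) (n : nat) (zeta eta X : R) : Prop :=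
  exists P : {poly int},
    [/\ (size P <= n.+1)%N,
        (height P)%:R <= X,
        0 < `|ieval P zeta|
      & `|ieval P zeta| <= X `^ (- eta)].

(* [y i] is the integer written y_{i+1} when indices start from 1. The default
   value 0 of the maximum is harmless, all the terms being nonnegative. *)
Definition simult_system (R : realType) (n : nat) (zeta eta X : R) : Prop :=
  exists (x : int) (y : 'I_n -> int),
    [/\ 0 < `|x|,
        `|x|%:~R <= X
      & \big[Num.max/0]_(i < n) `|zeta ^+ i.+1 * x%:~R - (y i)%:~R|
          <= X `^ (- eta)].

(* The exponents may be infinite, hence the suprema are taken in [\bar R]. *)
Definition w_exp (R : realType) (n : nat) (zeta : R) : \bar R :=
  ereal_sup [set eta%:E | eta in
    [set eta : R | arbitrarily_large (poly_system n zeta eta)]].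

Definition what_exp (R : realType) (n : nat) (zeta : R) : \bar R :=
  ereal_sup [set eta%:E | eta in
    [set eta : R | sufficiently_large (poly_system n zeta eta)]].

Definition lambda_exp (R : realType) (n : nat) (zeta : R) : \bar R :=
  ereal_sup [set eta%:E | eta in
    [set eta : R | arbitrarily_large (simult_system n zeta eta)]].

Definition lambdahat_exp (R : realType) (n : nat) (zeta : R) : \bar R :=
  ereal_sup [set eta%:E | eta in
    [set eta : R | sufficiently_large (simult_system n zeta eta)]].

Definition transcendental (R : realType) (zeta : R) : Prop :=
  ~ algebraicOver (ratr : rat -> R) zeta.

Definition extremal_number (R : realType) (zeta : R) : Prop :=
  transcendental zeta /\ what_exp 2 zeta = ((3 + Num.sqrt 5) / 2)%:E.

(* Main.v *)
Require Import Defs.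
From mathcomp Require Import all_boot all_order all_algebra.
From mathcomp Require Import all_classical all_reals all_analysis.
From mathcomp Require Import ring lra zify.

(**
Write g = (1 + sqrt 5) / 2, so that g^2 = (3 + sqrt 5) / 2, g^3 = 2 + sqrt 5 and
1 / (2 g) = (sqrt 5 - 1) / 4.  Let P_0, P_1, ... be the integer polynomials of
degree at most 2 that are minimal at zeta, with heights H_i.  The uniform exponent
g^2 > 2 forces the P_i to be irreducible for large i.  Call i a turn if P_(i-1), P_i,
P_(i+1) are linearly independent.  Determinants and resultants show that
H_i = H_j^(g + o(1)) for consecutive turns j < i, and that
|P_i(zeta)| = H_i^(- g^3 + o(1)) at a turn.  Hence for three consecutive turns
k < j < i, with Q = P_i, Q' = P_j, Q'' = P_k, the polynomials
Q, T Q, T^2 Q, Q' Q'' of degree at most 4 are linearly independent, have height at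
most X = H_i^(1 + o(1)) and values at most X^(- g^3 + o(1)) at zeta.  The integer
vector y orthogonal to all four satisfies |y_0| <= X^(4 + o(1)) and
|y_i - zeta^i y_0| <= X^(3 - g^3 + o(1)), and (g^3 - 3) / 4 = (sqrt 5 - 1) / 4.

If w_4(zeta) = g^3, Khintchine's transference gives
lambda_4(zeta) <= (g^3 - 3) / 4.  So every nonzero integer vector proportional to y
has first coordinate at least X^(4 - o(1)).  An integer polynomial P of degree at
most 4 with height at most X^(1 - r) and |P(zeta)| < X^(- 4 - r) would be orthogonal to
y; exchanging it for one of the four polynomials would give a shorter vector
proportional to y.  A vector z with |z_0| <= X^(4 - r) and errors below X^(- 1 - r)
would be orthogonal to the four polynomials, hence proportional to y.
*)

Import Order.TTheory GRing.Theory Num.Theory.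

Local Open Scope ring_scope.

Set Implicit Arguments.
Unset Strict Implicit.
Unset Printing Implicit Defensive.

(** * Exponents, integer linear forms and pigeonhole *)

Lemma powR_absorb (R : realType) (C a b : R) : a < b ->
  exists X0 : R, 1 <= X0 /\ forall X, X0 <= X -> C * X `^ a <= X `^ b.
Proof.
move=> ab; have d0 : 0 < b - a by rewrite subr_gt0.
(* Past this point X^(b - a) has reached max(C, 1). *)
exists (Num.max 1 ((Num.max C 1) `^ (b - a)^-1)); split.
  by rewrite le_max lexx.
move=> X; rewrite ge_max => /andP[X1 XC].
have Xp : 0 < X by apply: lt_le_trans X1.
have -> : X `^ b = X `^ (b - a) * X `^ a.
  by rewrite -powRD ?subrK //; apply/implyP => _; rewrite gt_eqF.
apply: ler_wpM2r; first exact: powR_ge0.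
apply: (@le_trans _ _ (Num.max C 1)); first by rewrite le_max lexx.
have M0 : 0 <= Num.max C 1 by rewrite le_max ler01 orbT.
rewrite -[leLHS]powRr1 // -[X in _ `^ X](@mulVf _ (b - a)) ?gt_eqF // powRrM.
by apply: ge0_ler_powR => //; rewrite ?nnegrE ?powR_ge0 //; apply: ltW.
Qed.

Lemma powR_absorb_lt (R : realType) (C a b : R) : a < b ->
  exists X0 : R, 1 <= X0 /\ forall X, X0 <= X -> C * X `^ a < X `^ b.
Proof.
move=> /(@powR_absorb R (C + 1)) [X0 [X01 H]]; exists X0; split=> // X XX0.
apply: lt_le_trans (H _ XX0); rewrite ltr_pM2r; first by rewrite ltrDl.
by rewrite powR_gt0 //; apply: lt_le_trans (le_trans X01 XX0).
Qed.

Lemma le_ereal_sup_lt (R : realType) (S : set R) (a : R) :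
  (forall eta, eta < a -> S eta) ->
  (a%:E <= ereal_sup [set eta%:E | eta in S])%E.
Proof.
move=> H; apply/lee_subgt0Pr => e e0; apply: ereal_sup_ubound.
by exists (a - e) => //; apply: H; rewrite ltrBlDr ltrDl.
Qed.

Lemma ereal_sup_le_real (R : realType) (S : set R) (a : R) :
  (forall eta, S eta -> eta <= a) ->
  (ereal_sup [set eta%:E | eta in S] <= a%:E)%E.
Proof. by move=> H; apply: ge_ereal_sup => _ [eta Se <-]; rewrite lee_fin H. Qed.

Lemma lt_ereal_sup_real (R : realType) (S : set R) (a eta : R) :
  (a%:E <= ereal_sup [set eta%:E | eta in S])%E -> eta < a ->
  exists2 eta', S eta' & eta < eta'.
Proof.
move=> H ea; have /ereal_sup_gt[_ [e Se <-]] :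
  (eta%:E < ereal_sup [set eta%:E | eta in S])%E by apply: lt_le_trans H.
by rewrite lte_fin; exists e.
Qed.

Definition lform (R : realType) (n : nat) (z : R) (v : 'I_n -> int) : R :=
  \sum_(i < n) (v i)%:~R * z ^+ i.

Lemma poly_systemP (R : realType) n (z eta X : R) : 0 <= X ->
  poly_system n z eta X <->
  exists v : 'I_n.+1 -> int,
    [/\ forall i, `|v i|%:~R <= X, lform z v != 0
      & `|lform z v| <= X `^ (- eta)].
Proof.
move=> X0; split=> [[P [sP hP P0 Pe]]|[v [vX v0 ve]]].
  have E : ieval P z = lform z (fun i : 'I_n.+1 => P`_i).
    rewrite /ieval /lform (@horner_coef_wide _ n.+1) ?(leq_trans (size_poly _ _)) //.
    by apply: eq_bigr => i _; rewrite coef_map.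
  exists (fun i : 'I_n.+1 => P`_i); rewrite -E; split=> // [i|]; last by rewrite -normr_gt0.
  case: (ltnP i (size P)) => [iP|iP]; last by rewrite nth_default // normr0.
  apply: le_trans hP; rewrite -abszE pmulrn ler_nat /height.
  exact: (@leq_bigmax_cond _ xpredT (fun j : 'I_(size P) => absz P`_j) (Ordinal iP)).
pose P := \poly_(i < n.+1) v (inord i).
have sP : (size P <= n.+1)%N by apply: size_poly.
have cP (i : 'I_n.+1) : P`_i = v i by rewrite coef_poly ltn_ord inord_val.
have E : ieval P z = lform z v.
  rewrite /ieval /lform (@horner_coef_wide _ n.+1) ?(leq_trans (size_poly _ _)) //.
  by apply: eq_bigr => i _; rewrite coef_map /= cP.
exists P; rewrite E normr_gt0; split=> //; rewrite /height.
elim/big_ind: _ => // [x y xX yX|i _]; first by rewrite /maxn; case: ifP.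
have iN : (i < n.+1)%N by apply: leq_trans sP.
by rewrite (cP (Ordinal iN)); have := vX (Ordinal iN); rewrite -abszE.
Qed.

Lemma transcendental_lform (R : realType) n (z : R) (v : 'I_n -> int) i :
  transcendental z -> v i != 0 -> lform z v != 0.
Proof.
case: n v i => [v []//|n] v i tz vi; apply/eqP => v0; apply: tz.
pose p : {poly rat} := \poly_(i < n.+1) (v (inord i))%:~R.
exists p.
  apply: contra vi => /eqP/polyP/(_ i).
  by rewrite coef_poly ltn_ord inord_val coef0 => /eqP; rewrite intr_eq0.
rewrite /root (@horner_coef_wide _ n.+1) ?(leq_trans (size_poly _ _)) ?size_poly //.
rewrite -[X in _ == X]v0 /lform; apply/eqP; apply: eq_bigr => j _.
by rewrite coef_map /= coef_poly ltn_ord inord_val ratr_int.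
Qed.

Lemma simult_systemP (R : realType) n (z eta X : R) :
  simult_system n z eta X <->
  exists (x : int) (y : 'I_n -> int),
    [/\ x != 0, `|x|%:~R <= X
      & forall i : 'I_n, `|z ^+ i.+1 * x%:~R - (y i)%:~R| <= X `^ (- eta)].
Proof.
split=> -[x [y [x0 xX yX]]]; exists x, y; split=> //; rewrite ?normr_gt0 // -?normr_gt0 //.
  by move=> i; move/bigmax_leP: yX => [_]; apply.
by apply: bigmax_le => //; exact: powR_ge0.
Qed.

Lemma poly_system_mono (R : realType) n (z eta eta' X : R) : 1 <= X ->
  eta <= eta' -> poly_system n z eta' X -> poly_system n z eta X.
Proof.
move=> X1 ee [P [sP hP P0 Pe]]; exists P; split=> //.
by apply: le_trans Pe _; rewrite ler_powR // lerN2.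
Qed.

Lemma what_exp_gt (R : realType) n (z a eta : R) :
  (a%:E <= what_exp n z)%E -> eta < a ->
  exists X0 : R, 1 <= X0 /\ forall X, X0 <= X -> poly_system n z eta X.
Proof.
move=> H ea; have [e [X0 HX] ee] := lt_ereal_sup_real H ea.
exists (Num.max 1 X0); split=> [|X]; first by rewrite le_max lexx.
rewrite ge_max => /andP[X1 XX0].
exact: poly_system_mono X1 (ltW ee) (HX _ XX0).
Qed.

Lemma w_exp_lt (R : realType) n (z a eta : R) :
  (w_exp n z <= a%:E)%E -> a < eta ->
  exists X0 : R, 1 <= X0 /\ forall X, X0 <= X -> ~ poly_system n z eta X.
Proof.
move=> H ea; have /existsNP[X0 HX] : ~ arbitrarily_large (poly_system n z eta).
  move=> A; have : (eta%:E <= a%:E)%E.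
    by apply: le_trans H; apply: ereal_sup_ubound; exists eta.
  by rewrite lee_fin leNgt ea.
exists (Num.max 1 X0); split=> [|X]; first by rewrite le_max lexx.
by rewrite ge_max => /andP[X1 XX0] S; apply: HX; exists X.
Qed.

Lemma finite_pigeonhole (T T' : finType) (f : T -> T') :
  (#|T'| < #|T|)%N -> exists x y, x != y /\ f x = f y.
Proof.
move=> H; have /injectivePn[x [y xy fxy]] : ~~ injectiveb f.
  by apply: contraL H => /injectiveP/leq_card; rewrite -leqNgt.
by exists x, y.
Qed.

Lemma truncn_eq_dist (R : realType) (x y : R) : 0 <= x -> 0 <= y ->
  Num.truncn x = Num.truncn y -> `|x - y| <= 1.
Proof.
move=> /truncn_itv/andP[x1 x2] /truncn_itv/andP[y1 y2] E.
rewrite E in x1 x2; rewrite -natr1 in x2; rewrite -natr1 in y2.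
by rewrite ler_norml; apply/andP; split; lra.
Qed.

(** Pigeonhole: the (B + 1)^(n + 1) vectors with coordinates in 0..B are sent to B^(n + 1) cells of
    equal length, and [v] is the difference of two vectors in one cell. *)
Lemma small_linear_form (R : realType) n (th : 'I_n.+1 -> R) (C : R) (B : nat) :
  0 < C -> (0 < B)%N -> (forall i, `|th i| <= C) ->
  exists v : 'I_n.+1 -> int,
    [/\ exists i, v i != 0, forall i, `|v i| <= B%:Z
      & `|\sum_(i < n.+1) (v i)%:~R * th i| <= 4 * n.+1%:R * C * B%:R ^- n].
Proof.
move=> C0 B0 thC.
have BR : (0 : R) < B%:R by rewrite ltr0n.
have n1 : (0 : R) < n.+1%:R by rewrite ltr0n.
(* [D] is twice the bound on |S|, so that the rescaled value [F] stays strictly under [N]. A cell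
   has length 2 D / N in terms of [S], which is the bound claimed. *)
pose N := (B ^ n.+1)%N; pose D : R := 2 * n.+1%:R * C * B%:R.
have D0 : 0 < D by rewrite /D !mulr_gt0.
have N0 : (0 : R) < N%:R by rewrite ltr0n expn_gt0 B0.
pose S (v : {ffun 'I_n.+1 -> 'I_B.+1}) : R := \sum_i (v i)%:R * th i.
have SD v : `|S v| <= D / 2.
  apply: le_trans (ler_norm_sum _ _ _) _.
  have -> : D / 2 = \sum_(i < n.+1) B%:R * C.
    by rewrite sumr_const card_ord -mulr_natl /D; field.
  apply: ler_sum => i _; rewrite normrM ger0_norm // ler_pM // ler_nat.
  by rewrite -ltnS.
pose F v : R := N%:R * ((S v + D) / (2 * D)).
have F1 v : 0 <= F v < N%:R.
  have := SD v; rewrite ler_norml => /andP[s1 s2]; apply/andP; split.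
    by rewrite mulr_ge0 ?(ltW N0) // divr_ge0 //; lra.
  by rewrite /F -[ltRHS]mulr1 ltr_pM2l // ltr_pdivrMr; lra.
have cell v : (Num.truncn (F v) < N)%N.
  have /andP[f0 fN] := F1 v; rewrite -(ltr_nat R).
  by apply: le_lt_trans fN; have /andP[] := truncn_itv f0.
have [] := @finite_pigeonhole _ _ (fun v => Ordinal (cell v)).
  by rewrite card_ffun !card_ord ltn_exp2r.
move=> v [w [vw [E]]]; exists (fun i => (v i)%:Z - (w i)%:Z); split.
- apply/existsP; apply: contraR vw; rewrite negb_exists => /forallP H.
  apply/eqP/ffunP => i; move: (H i); rewrite negbK subr_eq0 => /eqP[?].
  exact/val_inj.
- move=> i; have := ltn_ord (v i); have := ltn_ord (w i); lia.
have -> : \sum_(i < n.+1) ((v i)%:Z - (w i)%:Z)%:~R * th i = S v - S w.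
  by rewrite -sumrB; apply: eq_bigr => i _; rewrite intrB mulrBl.
have /andP[v0 _] := F1 v; have /andP[w0 _] := F1 w.
have := truncn_eq_dist v0 w0 E.
have -> : F v - F w = N%:R / (2 * D) * (S v - S w) by rewrite /F; field; lra.
rewrite normrM gtr0_norm ?divr_gt0 ?mulr_gt0 // mulrC -ler_pdivlMr; last first.
  by rewrite divr_gt0 ?mulr_gt0.
move=> /le_trans; apply; rewrite /D /N natrX exprS.
rewrite le_eqVlt; apply/orP; left; apply/eqP; field.
by rewrite !gt_eqF ?exprn_gt0 ?mulr_gt0.
Qed.

(** Dirichlet's theorem: the fractional parts of N^n + 1 multiples of [th] are distributed over N^n
    cubes of side 1 / N. *)
Lemma dirichlet_simultaneous (R : realType) n (th : 'I_n -> R) (N : nat) :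
  (0 < N)%N -> exists (x : int) (y : 'I_n -> int),
    [/\ x != 0, `|x| <= (N ^ n)%:Z
      & forall i, `|th i * x%:~R - (y i)%:~R| <= N%:R^-1].
Proof.
move=> N0; have NR : (0 : R) < N%:R by rewrite ltr0n.
pose fr (x : nat) i : R := th i * x%:R - (Num.floor (th i * x%:R))%:~R.
have fr1 x i : 0 <= fr x i < 1.
  have := floor_itv (th i * x%:R); rewrite intrD => /andP[h1 h2].
  by rewrite /fr; apply/andP; split; lra.
have cell x i : (Num.truncn (N%:R * fr x i) < N)%N.
  have /andP[f0 f1] := fr1 x i; rewrite -(ltr_nat R).
  have : 0 <= N%:R * fr x i by rewrite mulr_ge0 ?(ltW NR).
  move=> /truncn_itv/andP[h _]; apply: le_lt_trans h _.
  by rewrite -[ltRHS]mulr1 ltr_pM2l.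
have [] := @finite_pigeonhole 'I_(N ^ n).+1 {ffun 'I_n -> 'I_N}
  (fun x => [ffun i => Ordinal (cell x i)]).
  by rewrite card_ffun !card_ord.
move=> a [b [ab E]].
exists (a%:Z - b%:Z), (fun i => Num.floor (th i * a%:R) - Num.floor (th i * b%:R)).
split.
- by apply: contra ab; rewrite subr_eq0 => /eqP[?]; apply/eqP/val_inj.
- have := ltn_ord a; have := ltn_ord b; lia.
move=> i; move/ffunP: E => /(_ i); rewrite !ffunE => -[E].
have /andP[a0 _] := fr1 a i; have /andP[b0 _] := fr1 b i.
have := truncn_eq_dist (mulr_ge0 (ltW NR) a0) (mulr_ge0 (ltW NR) b0) E.
rewrite -mulrBr normrM gtr0_norm // mulrC -ler_pdivlMr // mul1r.
suff -> : fr a i - fr b i = th i * (a%:Z - b%:Z)%:~R -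
  (Num.floor (th i * a%:R) - Num.floor (th i * b%:R))%:~R by [].
by rewrite /fr !intrB; ring.
Qed.

(** * Generalised cross products *)

(** Signed maximal minors, taken as cofactors along an extra top row. Each minor deletes that row,
    so its entries [0] are arbitrary. *)
Definition crossv (S : comPzRingType) m (M : 'M[S]_(m, m.+1)) (j : 'I_m.+1) : S :=
  cofactor (col_mx 0 M : 'M[S]_(1 + m)) 0 j.

Lemma det_col_mx_cross (S : comPzRingType) m (r : 'rV[S]_m.+1) (M : 'M[S]_(m, m.+1)) :
  \det (col_mx r M : 'M[S]_(1 + m)) = \sum_j r 0 j * crossv M j.
Proof.
rewrite (expand_det_row _ ord0); apply: eq_bigr => j _; congr (_ * _).
  by rewrite mxE; case: splitP => [i _|i] //; rewrite (ord1 i).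
rewrite /crossv /cofactor; congr (_ * \det _); apply/matrixP => i k; rewrite !mxE.
by case: splitP => // -[[|?] //= _].
Qed.

Lemma col_mx_row0 (S : Type) m n (r : 'rV[S]_n) (M : 'M[S]_(m, n)) j :
  (col_mx r M : 'M[S]_(1 + m, n)) 0 j = r 0 j.
Proof. by rewrite mxE; case: splitP => [i _|i] //; rewrite (ord1 i). Qed.

Lemma col_mx_lift0 (S : Type) m n (r : 'rV[S]_n) (M : 'M[S]_(m, n)) k j :
  (col_mx r M : 'M[S]_(1 + m, n)) (lift 0 k) j = M k j.
Proof.
rewrite mxE; case: splitP => [i|i]; first by rewrite (ord1 i).
by move=> /eqP; rewrite eqSS => /eqP/val_inj ->.
Qed.

Lemma cross_orthogonal (S : comPzRingType) m (M : 'M[S]_(m, m.+1)) k :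
  \sum_j M k j * crossv M j = 0.
Proof.
have -> : \sum_j M k j * crossv M j = \det (col_mx (row k M) M : 'M[S]_(1 + m)).
  by rewrite det_col_mx_cross; apply: eq_bigr => j _; rewrite mxE.
apply: (@determinant_alternate _ _ _ (lshift m 0) (rshift 1 k)).
  by apply/eqP => /(congr1 val).
by move=> j; rewrite col_mxEu col_mxEd mxE.
Qed.

Lemma det_bound (R : realType) n (A : 'M[R]_n) (B : 'I_n -> R) :
  (forall i j, `|A i j| <= B i) -> `|\det A| <= n`!%:R * \prod_i B i.
Proof.
move=> H; rewrite /determinant; apply: le_trans (ler_norm_sum _ _ _) _.
rewrite -perm.card_Sn mulr_natl -sumr_const.
apply: ler_sum => s _; rewrite normrM normrX normrN1 expr1n mul1r normr_prod.
by apply: ler_prod => i _; rewrite normr_ge0 H.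
Qed.

Lemma cofactor_col_mx_bound (R : realType) m (r : 'rV[R]_m.+2)
    (M : 'M[R]_(m.+1, m.+2)) (D X : R) (k : 'I_m.+1) j :
  (forall j, `|r 0 j| <= D) -> (forall i j, `|M i j| <= X) ->
  `|cofactor (col_mx r M : 'M[R]_(1 + m.+1)) (lift 0 k) j| <= m.+1`!%:R * (D * X ^+ m).
Proof.
move=> hr hM; rewrite /cofactor normrM normrX normrN1 expr1n mul1r.
pose B (i : 'I_m.+1) := if i == 0 then D else X.
have -> : D * X ^+ m = \prod_i B i.
  rewrite big_ord_recl {1}/B eqxx; congr (_ * _).
  rewrite (eq_bigr (fun _ => X)); first by rewrite prodr_const card_ord.
  by move=> i _; rewrite /B.
apply: det_bound => i j'; rewrite !mxE; case: splitP => [i' E|i' E]; last first.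
  rewrite /B; case: eqP => // i0; exfalso.
  by move: E; rewrite i0 /= /bump /= => /eqP.
rewrite (ord1 i') (_ : i = 0) /B ?eqxx ?hr //; apply/val_inj => /=.
by move: E; rewrite (ord1 i') /= /bump; case: leqP => // _; case: (i : nat).
Qed.

Lemma cross_bound (R : realType) m (M : 'M[R]_(m, m.+1)) (X : R) j :
  (forall i j, `|M i j| <= X) -> `|crossv M j| <= m`!%:R * X ^+ m.
Proof.
move=> hM; rewrite /crossv /cofactor normrM normrX normrN1 expr1n mul1r.
have -> : X ^+ m = \prod_(i < m) X by rewrite prodr_const card_ord.
apply: det_bound => i j'; rewrite !mxE.
by case: splitP => // -[[|?] //= _].
Qed.

(** The error is the determinant of [M] under the row e_i - z^i e_0. That row annihilates (1, z,
    z^2, ...), so the adjugate expresses the determinant through the values of the rows of [M] at z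
    alone, each weighted by a cofactor. *)
Lemma cross_error_bound (R : realType) m (M : 'M[R]_(m.+1, m.+2)) (z D X e : R) i :
  1 <= D -> (forall i : 'I_m.+2, `|z| ^+ i <= D) -> (forall i j, `|M i j| <= X) ->
  (forall k, `|\sum_j M k j * z ^+ j| <= e) ->
  `|crossv M i - z ^+ i * crossv M 0| <=
     m.+1%:R * (m.+1`!%:R * (2 * D * X ^+ m) * e).
Proof.
move=> D1 hz hM he.
pose r : 'rV[R]_m.+2 := \row_j ((j == i)%:R - (j == 0)%:R * z ^+ i).
pose A : 'M[R]_(1 + m.+1) := col_mx r M.
have hr j : `|r 0 j| <= 2 * D.
  rewrite mxE; apply: le_trans (ler_normB _ _) _; rewrite [leRHS]mulr_natl mulr2n lerD //.
    by case: eqP; rewrite ?normr1 // normr0 (le_trans ler01).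
  rewrite normrM normrX; case: eqP => _; first by rewrite normr1 mul1r hz.
  by rewrite normr0 mul0r (le_trans ler01).
have Ed : \det A = crossv M i - z ^+ i * crossv M 0.
  rewrite det_col_mx_cross.
  rewrite (eq_bigr (fun j => (j == i)%:R * crossv M j - (j == 0)%:R * (z ^+ i * crossv M j))).
    rewrite sumrB (bigD1 i) //= eqxx mul1r big1 ?addr0; last first.
      by move=> j /negPf ->; rewrite mul0r.
    rewrite (bigD1 0) //= mul1r [X in _ - (_ + X)]big1 ?addr0 // => j /negPf ->.
    by rewrite mul0r.
  by move=> j _; rewrite mxE mulrBl mulrA.
rewrite -Ed.
pose v : 'cV[R]_(1 + m.+1) := \col_j z ^+ j.
(* Coordinate 0 of adj(A) A v = det(A) v, where v_0 = 1. *)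
have := congr1 (fun B => (B *m v) 0 0) (mul_adj_mx A).
rewrite mul_scalar_mx [RHS]mxE [v 0 0]mxE expr0 mulr1 => <-.
rewrite -mulmxA mxE big_ord_recl.
have -> : (A *m v) 0 0 = 0.
  rewrite mxE (eq_bigr (fun j => (j == i)%:R * z ^+ j - (j == 0)%:R * (z ^+ i * z ^+ j))).
    rewrite sumrB (bigD1 i) //= eqxx mul1r big1 ?addr0; last first.
      by move=> j /negPf ->; rewrite mul0r.
    rewrite (bigD1 0) //= mul1r [X in _ - (_ + X)]big1 ?addr0 ?expr0 ?mulr1 ?subrr //.
    by move=> j /negPf ->; rewrite mul0r.
  by move=> j _; rewrite /A col_mx_row0 !mxE mulrBl mulrA.
rewrite mulr0 add0r; apply: le_trans (ler_norm_sum _ _ _) _.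
rewrite mulr_natl -[X in _ *+ X]card_ord -sumr_const; apply: ler_sum => k _.
rewrite normrM ler_pM //.
  by rewrite mxE; apply: cofactor_col_mx_bound.
apply: le_trans (he k); rewrite le_eqVlt; apply/orP; left; apply/eqP.
congr (`|_|); rewrite mxE; apply: eq_bigr => j _; by rewrite [v j 0]mxE /A col_mx_lift0.
Qed.

(** The row space misses some unit vector; placed on top of [M], that vector gives an invertible
    matrix, whose determinant is a combination of the minors. *)
Lemma cross_neq0 (F : fieldType) m (M : 'M[F]_(m, m.+1)) :
  (forall c : 'rV[F]_m, c *m M = 0 -> c = 0) -> exists j, crossv M j != 0.
Proof.
move=> H; have rM : \rank M = m by apply/eqP; exact: inj_row_free.
have : ~~ (1%:M <= M)%MS by rewrite sub1mx /row_full rM neq_ltn ltnSn.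
move=> /row_subP/existsNP[i /negP hi].
set r := row i _ in hi.
have : row_free (col_mx r M : 'M[F]_(1 + m)).
  apply: inj_row_free => u; rewrite -[u]hsubmxK mul_row_col.
  set u0 := lsubmx u; set u1 := rsubmx u => E.
  have u00 : u0 = 0.
    rewrite (mx11_scalar u0); case: (eqVneq (u0 0 0) 0) => [->|n0].
      by rewrite -scalemx1 scale0r.
    case/negP: hi; apply/submxP; exists (- (u0 0 0)^-1 *: u1).
    move: E; rewrite {1}(mx11_scalar u0) mul_scalar_mx => /eqP.
    rewrite addr_eq0 => /eqP E; rewrite -scalemxAl.
    by rewrite scaleNr -scalerN -E scalerA mulVf // scale1r.
  by move: E; rewrite u00 mul0mx add0r => /H ->; rewrite row_mx0.
rewrite row_free_unit unitmxE unitfE det_col_mx_cross => S0.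
apply/existsP; apply: contraR S0; rewrite negb_exists => /forallP Z.
by apply/eqP; apply: big1 => j _; move: (Z j); rewrite negbK => /eqP ->; rewrite mulr0.
Qed.

(** With y the cross product, y_0 z - z_0 y is killed by [M] and has first coordinate 0. It is
    therefore killed by the square matrix with e_0 on top of [M], whose determinant is y_0. *)
Lemma kernel_proportional (S : idomainType) m (M : 'M[S]_(m, m.+1)) (z : 'I_m.+1 -> S) :
  crossv M 0 != 0 -> (forall k, \sum_j M k j * z j = 0) ->
  forall i, crossv M 0 * z i = z 0 * crossv M i.
Proof.
move=> y0 Mz i.
pose r : 'rV[S]_m.+1 := \row_j (j == 0)%:R.
pose A : 'M[S]_(1 + m) := col_mx r M.
pose d : 'cV[S]_(1 + m) := \col_j (crossv M 0 * z j - z 0 * crossv M j).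
have dA : \det A = crossv M 0.
  rewrite det_col_mx_cross (bigD1 0) //= mxE eqxx mul1r big1 ?addr0 // => j /negPf h.
  by rewrite mxE h mul0r.
have Ad : A *m d = 0.
  apply/matrixP => k l; rewrite (ord1 l) [RHS]mxE mxE.
  case: (unliftP 0 k) => [k'|] ->; last first.
    rewrite big1 // => j _; rewrite col_mx_row0 mxE.
    by case: eqP => [->|_]; rewrite ?mul0r // mul1r mxE mulrC subrr.
  transitivity (crossv M 0 * (\sum_j M k' j * z j) - z 0 * \sum_j M k' j * crossv M j).
    rewrite !mulr_sumr -sumrB; apply: eq_bigr => j _; rewrite col_mx_lift0 mxE.
    by ring.
  by rewrite Mz cross_orthogonal !mulr0 subr0.
have : (\adj A *m (A *m d)) i 0 = 0 by rewrite Ad mulmx0 mxE.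
rewrite mulmxA mul_adj_mx mul_scalar_mx !mxE dA => /eqP.
by rewrite mulf_eq0 (negPf y0) /= subr_eq0 => /eqP.
Qed.

(** Being orthogonal to y = [crossv M], [P] is a rational combination of the rows of [M]. A row
    occurring in it can be exchanged for [P]: the new cross product [t] stays proportional to y,
    while one factor [X] of its size is replaced by [H]. *)
Lemma orthogonal_exchange (R : realType) m (M : 'M[int]_(m.+1, m.+2))
    (P : 'I_m.+2 -> int) (X H : R) :
  crossv M 0 != 0 -> \sum_j P j * crossv M j = 0 -> (exists i, P i != 0) ->
  (forall i j, `|M i j|%:~R <= X) -> (forall i, `|P i|%:~R <= H) ->
  exists t : 'I_m.+2 -> int,
    [/\ t 0 != 0, forall i, crossv M 0 * t i = t 0 * crossv M i
      & `|t 0|%:~R <= m.+2%:R * (H * (m.+1`!%:R * X ^+ m))].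
Proof.
move=> y0 Py [i0 Pi0] hM hP.
pose r i : 'rV[int]_m.+2 := \row_j (j == i)%:R.
pose A i : 'M[int]_(1 + m.+1) := col_mx (r i) M.
pose p : 'rV[int]_(1 + m.+1) := \row_j P j.
have dA i : \det (A i) = crossv M i.
  rewrite det_col_mx_cross (bigD1 i) //= mxE eqxx mul1r big1 ?addr0 // => j /negPf h.
  by rewrite mxE h mul0r.
pose s := p *m \adj (A 0).
pose y : 'cV[int]_(1 + m.+1) := \col_j crossv M j.
have Es : crossv M 0 *: p = s *m A 0.
  by rewrite /s -mulmxA mul_adj_mx dA mul_mx_scalar.
have Ay i : A i *m y = col_mx (crossv M i)%:M 0.
  rewrite mul_col_mx; congr col_mx.
    apply/matrixP => a b; rewrite !ord1 !mxE (bigD1 i) //= !mxE eqxx mul1r.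
    by rewrite big1 ?addr0 // => j /negPf h; rewrite mxE h mul0r.
  apply/matrixP => k l; rewrite (ord1 l) [RHS]mxE mxE -[RHS](cross_orthogonal M k).
  by apply: eq_bigr => j _; rewrite mxE.
(* Pairing y_0 P = s A_0 with y leaves only s_0 y_0 on the right, because the rows of [M] kill y. *)
have s0 : s 0 0 = 0.
  have : crossv M 0 * (p *m y) 0 0 = (s *m (A 0 *m y)) 0 0.
    by rewrite mulmxA -Es -scalemxAl [RHS]mxE.
  rewrite (_ : (p *m y) 0 0 = 0); last first.
    by rewrite mxE -[RHS]Py; apply: eq_bigr => j _; rewrite !mxE.
  rewrite mulr0 Ay mxE (bigD1 0) //= big1 ?addr0; last first.
    move=> k; case: (unliftP 0 k) => [k'|] -> //.
    by rewrite col_mx_lift0 [X in _ * X]mxE mulr0.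
  rewrite col_mx_row0 [X in _ * X]mxE eqxx mulr1n => /esym/eqP.
  by rewrite mulf_eq0 (negPf y0) orbF => /eqP.
have Es' : crossv M 0 *: p = rsubmx s *m M.
  rewrite Es -{1}[s]hsubmxK mul_row_col (_ : lsubmx s = 0) ?mul0mx ?add0r //.
  apply/matrixP => a b; rewrite !ord1 [RHS]mxE [LHS]mxE -[RHS]s0.
  by congr (s _ _); apply: val_inj.
have [k sk] : exists k, rsubmx s 0 k != 0.
  apply/existsP; apply: contraR Pi0; rewrite negb_exists => /forallP Z.
  have S0 : rsubmx s = 0.
    by apply/matrixP => a b; rewrite (ord1 a) [RHS]mxE; apply/eqP; rewrite -[_ == _]negbK Z.
  move/matrixP: Es' => /(_ 0 i0); rewrite S0 mul0mx !mxE => /eqP.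
  by rewrite mulf_eq0 (negPf y0).
pose t i := (p *m \adj (A i)) 0 (rshift 1 k).
have t0 : t 0 = rsubmx s 0 k by rewrite /t [RHS]mxE.
exists t; rewrite t0; split=> // [i|].
  have -> : crossv M 0 * t i = (rsubmx s *m M *m \adj (A i)) 0 (rshift 1 k).
    by rewrite -Es' -scalemxAl [RHS]mxE.
  have -> : rsubmx s *m M = row_mx 0 (rsubmx s) *m A i by rewrite mul_row_col mul0mx add0r.
  by rewrite -mulmxA mul_mx_adj dA mul_mx_scalar mxE row_mxEr mulrC.
rewrite -t0 /t mxE intr_norm.
rewrite rmorph_sum /=; apply: le_trans (ler_norm_sum _ _ _) _.
rewrite mulr_natl -[X in _ *+ X](card_ord m.+2) -sumr_const; apply: ler_sum => j _.
rewrite intrM normrM ler_pM //; first by rewrite mxE -intr_norm.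
rewrite mxE.
have <- : cofactor (map_mx intr (A 0)) (rshift 1 k) j =
         (cofactor (A 0) (rshift 1 k) j)%:~R :> R.
  by rewrite cofactor_map_mx.
have -> : X ^+ m = 1 * X ^+ m by rewrite mul1r.
rewrite map_col_mx (_ : rshift 1 k = lift 0 k); last by apply: val_inj.
apply: cofactor_col_mx_bound => [j'|a b]; rewrite !mxE.
  by case: eqP; rewrite ?normr1 // normr0.
by rewrite -intr_norm.
Qed.

(** * Integer quadratic polynomials *)

(* (c, b, a) stands for the polynomial c + b T + a T^2. *)
Definition quad := (int * int * int)%type.

Definition qht (q : quad) : nat := maxn (maxn (absz q.1.1) (absz q.1.2)) (absz q.2).

Definition qev (R : realType) (z : R) (q : quad) : R :=
  q.1.1%:~R + q.1.2%:~R * z + q.2%:~R * z ^+ 2.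

Definition quad_uniform (R : realType) (z eta : R) : Prop :=
  exists X0 : R, 1 <= X0 /\ forall X, X0 <= X ->
    exists q : quad, [/\ q != 0, (qht q)%:R <= X & `|qev z q| <= X `^ (- eta)].

(** In degree exactly two, having no rational root is irreducibility over the rationals. *)
Definition irr_quad (q : quad) : Prop :=
  q.2 != 0 /\ forall r : rat, q.1.1%:~R + q.1.2%:~R * r + q.2%:~R * r ^+ 2 != 0.

Lemma quad0P (q : quad) : reflect [/\ q.1.1 = 0, q.1.2 = 0 & q.2 = 0] (q == 0).
Proof.
case: q => [[c b] a] /=; apply: (iffP eqP) => [[-> -> ->]//|[-> -> ->]//].
Qed.

Lemma absz_qht q : [/\ (absz q.1.1 <= qht q)%N, (absz q.1.2 <= qht q)%N & (absz q.2 <= qht q)%N].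
Proof. by rewrite /qht; split; rewrite !leq_max leqnn ?orbT. Qed.

Lemma qht_bound (R : realType) (q : quad) :
  [/\ `|q.1.1%:~R| <= (qht q)%:R :> R, `|q.1.2%:~R| <= (qht q)%:R :> R
    & `|q.2%:~R| <= (qht q)%:R :> R].
Proof.
by have [h1 h2 h3] := absz_qht q; split; rewrite -intr_norm -natr_absz ler_nat.
Qed.

Lemma qht_gt0 q : q != 0 -> (0 < qht q)%N.
Proof.
move=> q0; rewrite lt0n; apply: contra q0 => /eqP h; apply/quad0P.
by have := absz_qht q; rewrite h; case; split; lia.
Qed.

Lemma lform_quad (R : realType) (z : R) (v : 'I_3 -> int) :
  lform z v = qev z (v 0, v 1, v 2).
Proof.
rewrite /lform !big_ord_recl big_ord0 /qev /= expr0 mulr1 addr0 addrA expr1.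
by congr (_ + (v _)%:~R * _ + (v _)%:~R * _); apply: val_inj.
Qed.

Lemma qev_neq0 (R : realType) (z : R) q : transcendental z -> q != 0 -> qev z q != 0.
Proof.
move=> tz q0; pose v (i : 'I_3) := [:: q.1.1; q.1.2; q.2]`_i.
have -> : qev z q = lform z v by rewrite lform_quad /v /= /qev.
have [i vi] : exists i, v i != 0.
  apply/existsP; apply: contraR q0; rewrite negb_exists => /forallP H.
  apply/quad0P; split; apply/eqP.
  - by have := H 0; rewrite negbK.
  - by have := H 1; rewrite negbK.
  - by have := H 2; rewrite negbK.
exact: transcendental_lform vi.
Qed.

Lemma poly_system_quad (R : realType) (z eta X : R) : 0 <= X -> poly_system 2 z eta X ->
  exists q : quad, [/\ q != 0, (qht q)%:R <= X & `|qev z q| <= X `^ (- eta)].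
Proof.
move=> X0 /(poly_systemP _ _ _ X0)[v [vX v0 ve]].
exists (v 0, v 1, v 2); rewrite -lform_quad; split=> //.
  apply: contra v0 => /quad0P[/= h0 h1 h2].
  by rewrite lform_quad h0 h1 h2 /qev !mul0r !addr0.
have h i : (absz (v i))%:R <= X by rewrite natr_absz.
by rewrite /qht /=; case: (leqP (maxn _ _)) => _ //; case: leqP.
Qed.

(** * Rational approximation of z and reducible quadratics *)

Lemma dist_int_gt0 (R : realType) (u : R) : (forall p : int, u != p%:~R) ->
  exists c : R, 0 < c /\ forall p : int, c <= `|u - p%:~R|.
Proof.
move=> H; have /andP[f1 f2] := floor_itv u; set f := Num.floor u in f1 f2.
have f1' : f%:~R < u by rewrite lt_neqAle f1 eq_sym H.
rewrite intrD in f2; exists (Num.min (u - f%:~R) (f%:~R + 1 - u)); split.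
  by rewrite lt_min; apply/andP; split; lra.
move=> p; rewrite ge_min; case: (lerP p f) => pf; apply/orP; [left|right].
  have pfR : p%:~R <= f%:~R :> R by rewrite ler_int.
  by rewrite ger0_norm; lra.
have pfR : f%:~R + 1 <= p%:~R :> R by rewrite -(intrD _ f 1) ler_int; lia.
by rewrite ler0_norm; lra.
Qed.

Lemma small_denq_dist (R : realType) (z : R) (N : nat) : transcendental z ->
  exists c : R, 0 < c /\ forall r : rat, denq r <= N%:Z -> c <= `|z - ratr r|.
Proof.
move=> tz; elim: N => [|N [c [c0 IH]]].
  by exists 1; split=> // r; rewrite leNgt denq_gt0.
have [|c' [c'0 H]] := @dist_int_gt0 R (N.+1%:R * z).
  move=> p; rewrite -subr_eq0; have := @qev_neq0 _ z (- p, N.+1%:Z, 0) tz.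
  rewrite /qev /= mul0r addr0 addrC rmorphN /=; apply.
  by apply/negP => /quad0P[].
have N0 : (0 : R) < N.+1%:R by rewrite ltr0n.
exists (Num.min c (c' / N.+1%:R)); split; first by rewrite lt_min c0 divr_gt0.
move=> r; rewrite le_eqVlt => /orP[/eqP dr|dr]; last by rewrite ge_min IH //; lia.
rewrite ge_min; apply/orP; right; rewrite ler_pdivrMr //.
apply: le_trans (H (numq r)) _; rewrite le_eqVlt; apply/orP; left; apply/eqP.
rewrite -[X in _ = _ * X]gtr0_norm // -normrM; congr `|_|.
rewrite mulrBl mulrC; congr (_ - _).
by rewrite -[in RHS](divq_num_den r) dr rmorphM /= fmorphV /= !ratr_int mulfVK // gt_eqF.
Qed.

(** The denominator of a root divides the leading coefficient, which is [q.1.2] when [q.2] vanishes.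
    So a fraction whose denominator exceeds the height is not a root. *)
Lemma root_den (q : quad) (p d : int) : q != 0 -> 0 < d -> coprimez d p ->
  q.2 * p ^+ 2 + q.1.2 * p * d + q.1.1 * d ^+ 2 = 0 -> d <= (qht q)%:Z.
Proof.
case: q => [[c b] a] q0 d0 cdp /= E; have := absz_qht (c, b, a) => /= -[h1 h2 h3].
have le_dvd (x : int) : x != 0 -> (d %| x)%Z -> d <= (absz x)%:Z.
  move=> x0 /dvdzP[y xy]; have y0 : y != 0 by apply: contra x0; rewrite xy => /eqP->; rewrite mul0r.
  rewrite xy abszM; have : (1 <= absz y)%N by lia.
  have -> : d = (absz d)%:Z by lia.
  by move=> ?; rewrite lez_nat /= leq_pmull.
have [a0|a0] := eqVneq a 0.
  have [b0|b0] := eqVneq b 0.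
    move: E; rewrite a0 b0 !mul0r !add0r => /eqP; rewrite mulf_eq0 expf_eq0 /= (gt_eqF d0) orbF.
    by move=> /eqP c0; move: q0; rewrite a0 b0 c0.
  apply: (le_trans (le_dvd b b0 _)); last by rewrite lez_nat.
  rewrite -(@Gauss_dvdzl _ _ p) //; apply/dvdzP; exists (- c).
  apply: (@mulIf _ d); first by rewrite gt_eqF.
  by move: E; rewrite a0; lra.
apply: (le_trans (le_dvd a a0 _)); last by rewrite lez_nat.
rewrite -(@Gauss_dvdzl _ _ (p ^+ 2)) ?coprimezXr //; apply/dvdzP.
by exists (- (b * p + c * d)); move: E; lra.
Qed.

(** A quadratic of height at most d / 2 does not vanish at a rational of denominator d, hence is at
    least d^(-2) there in size. Since [eta] exceeds 2 it is much smaller at z, and its slope of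
    order at most d then forces |z - r| to be at least of order d^(-3). *)
Lemma linear_gap_rat (R : realType) (z eta : R) : transcendental z -> 2 < eta ->
  quad_uniform z eta ->
  exists c : R, 0 < c /\ forall r : rat, c <= `|z - ratr r| * (denq r)%:~R ^+ 3.
Proof.
move=> tz eta2 [X0 [X01 HX]].
have [X1 [X11 HX1]] : exists X0 : R, 1 <= X0 /\ forall X, X0 <= X ->
    8 * X `^ (2 - eta) <= X `^ 0.
  by apply: powR_absorb; rewrite subr_lt0.
pose X2 := Num.max X0 X1.
pose N := Num.truncn (2 * X2).
have [c [c0 Hc]] := @small_denq_dist R z N tz.
pose Z : R := `|z| + 1.
have Z0 : 0 < Z by rewrite ltr_wpDl.
(* The three entries serve small denominators, rationals at distance at least 1 from z, and the main
   case. *)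
exists (Num.min c (Num.min 1 (4 * Z)^-1)); split.
  by rewrite !lt_min c0 ltr01 invr_gt0 mulr_gt0.
move=> r; set d : R := (denq r)%:~R.
have d1 : 1 <= d by rewrite (ler_int R 1) -gtz0_ge1 denq_gt0.
have d31 : 1 <= d ^+ 3 by rewrite exprn_ege1.
have [drN|drN] := lerP (denq r) N%:Z.
  rewrite ge_min; apply/orP; left; apply: le_trans (Hc _ drN) _.
  by rewrite ler_peMr.
have [zr1|zr1] := lerP 1 `|z - ratr r|.
  rewrite ge_min; apply/orP; right; rewrite ge_min; apply/orP; left.
  by apply: (le_trans d31); apply: ler_peMl => //; exact: le_trans ler01 d31.
rewrite ge_min; apply/orP; right; rewrite ge_min; apply/orP; right.
have d0 : 0 < d by apply: lt_le_trans d1.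
(* Height below d excludes a zero at r. With d = 2 X, the constant 8 in the choice of [X1] gives
   X^(- eta) d^2 <= 1 / 2. *)
pose X := d / 2.
have XX2 : X2 <= X.
  rewrite /X ler_pdivlMr // mulrC; apply/ltW.
  apply: (lt_le_trans (truncnS_gt _)); rewrite -/N /d.
  by rewrite -[leLHS]/(N.+1%:Z%:~R) ler_int; lia.
move: (XX2); rewrite ge_max => /andP[XX0 XX1].
have X0' : 0 < X by rewrite divr_gt0.
have [q [q0 qX qe]] := HX _ XX0.
pose F := q.2 * numq r ^+ 2 + q.1.2 * numq r * denq r + q.1.1 * denq r ^+ 2.
have F0 : F != 0.
  apply/eqP => /(root_den q0 (denq_gt0 r)) h.
  have cp : coprimez (denq r) (numq r) by rewrite coprimezE coprime_sym coprime_num_den.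
  have : d <= X.
    apply: le_trans qX; rewrite /d -[leRHS]/((qht q)%:Z%:~R) ler_int; exact: h.
  by rewrite /X; lra.
have F1 : 1 <= `|F%:~R : R|.
  by rewrite -intr_norm (ler_int R 1) -gtz0_ge1 normr_gt0.
set s : R := ratr r.
have sE : (numq r)%:~R = s * d :> R.
  by rewrite /s -{2}(divq_num_den r) rmorphM /= fmorphV /= !ratr_int mulfVK // gt_eqF.
have FE : F%:~R = d ^+ 2 * (qev z q - (z - s) * (q.1.2%:~R + q.2%:~R * (z + s))) :> R.
  by rewrite /F !(intrD, intrM, rmorphXn) /= sE -/d /qev; ring.
have [h1 h2 h3] := qht_bound R q.
have sz : `|z + s| <= 2 * Z.
  have -> : z + s = 2 * z - (z - s) by ring.
  apply: le_trans (ler_normB _ _) _; rewrite normrM ger0_norm // /Z.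
  have := ltW zr1; have := normr_ge0 z; lra.
have Bd : `|(z - s) * (q.1.2%:~R + q.2%:~R * (z + s))| <= `|z - s| * (X * (2 * Z + 1)).
  rewrite normrM ler_wpM2l //; apply: le_trans (ler_normD _ _) _.
  rewrite [leRHS]mulrDr mulr1 addrC lerD //; last exact: le_trans h2 qX.
  by rewrite normrM ler_pM // (le_trans h3).
have Xe : X `^ (- eta) * d ^+ 2 <= 1 / 2.
  have := HX1 _ XX1; rewrite powRr0 powRD; last by apply/implyP => _; rewrite gt_eqF.
  have -> : (2 : R) = 2%:R by [].
  rewrite (powR_mulrn _ (ltW X0')) (_ : d = 2 * X); last by rewrite /X; field.
  set v := X `^ _; lra.
have : 1 <= d ^+ 2 * (X `^ (- eta) + `|z - s| * (X * (2 * Z + 1))).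
  apply: (le_trans F1); rewrite FE normrM ger0_norm ?sqr_ge0 // ler_wpM2l ?sqr_ge0 //.
  by apply: le_trans (ler_normB _ _) _; rewrite lerD.
rewrite mulrDr [d ^+ 2 * X `^ _]mulrC => H.
have : 1 / 2 <= `|z - s| * d ^+ 3 * ((2 * Z + 1) / 2).
  apply: (@le_trans _ _ (d ^+ 2 * (`|z - s| * (X * (2 * Z + 1))))); first by lra.
  by rewrite le_eqVlt; apply/orP; left; apply/eqP; rewrite /X; field.
move=> H'; rewrite -[leLHS]mul1r ler_pdivrMr ?mulr_gt0 //.
have : 0 <= `|z - s| * d ^+ 3 by rewrite mulr_ge0 // exprn_ge0 // ltW.
have : 1 <= Z by rewrite lerDr.
nra.
Qed.

Lemma denq_le (m n : int) : n != 0 -> denq (m%:~R / n%:~R) <= `|n|.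
Proof.
move=> n0; set r : rat := _ / _.
have E : numq r * n = m * denq r.
  have rn : r * n%:~R = m%:~R by rewrite mulfVK // intr_eq0.
  apply: (@intr_inj rat); rewrite !intrM -rn.
  rewrite -[in LHS](mulfVK (_ : (denq r)%:~R != 0) (numq r)%:~R) ?intr_eq0 ?denq_neq0 //.
  by rewrite divq_num_den; ring.
have : (denq r %| n)%Z.
  rewrite -(@Gauss_dvdzr _ (numq r)) //; first by apply/dvdzP; exists m.
  by rewrite coprimezE coprime_sym coprime_num_den.
move=> /dvdzP[k nk]; have k0 : k != 0 by apply: contra n0; rewrite nk => /eqP->; rewrite mul0r.
rewrite nk normrM (gtr0_norm (denq_gt0 r)); apply: ler_peMl.
  exact/ltW/denq_gt0.
by rewrite -gtz0_ge1 normr_gt0.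
Qed.

Lemma linear_gap (R : realType) (z eta : R) : transcendental z -> 2 < eta ->
  quad_uniform z eta ->
  exists c : R, 0 < c /\ forall m n : int, n != 0 ->
    c <= `|n%:~R * z - m%:~R| * n%:~R ^+ 2.
Proof.
move=> tz e2 U; have [c [c0 H]] := linear_gap_rat tz e2 U; exists c; split=> // m n n0.
set r : rat := m%:~R / n%:~R.
have nR : (n%:~R : R) != 0 by rewrite intr_eq0.
apply: le_trans (H r) _.
have -> : n%:~R * z - m%:~R = n%:~R * (z - ratr r).
  by rewrite /r rmorphM /= fmorphV /= !ratr_int; field.
rewrite normrM -[n%:~R ^+ 2]ger0_norm ?sqr_ge0 // normrX.
have -> : `|n%:~R| * `|z - ratr r| * `|n%:~R| ^+ 2 = `|z - ratr r| * `|n%:~R : R| ^+ 3 by ring.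
apply: ler_wpM2l => //; apply: lerXn2r; rewrite ?nnegrE //.
  by rewrite ler0z; exact/ltW/denq_gt0.
by rewrite -intr_norm ler_int; exact: denq_le.
Qed.

(** A quadratic with a rational root is a product of two integer linear forms, each bounded below by
    [linear_gap]; the product of the two bounds contradicts smallness. A vanishing leading
    coefficient is excluded in a similar way. *)
Lemma irr_quad_of_small (R : realType) (z eta : R) : transcendental z -> 2 < eta ->
  quad_uniform z eta ->
  exists c : R, 0 < c /\ forall q : quad, q != 0 ->
    `|qev z q| * (qht q)%:R ^+ 2 < c -> irr_quad q.
Proof.
move=> tz e2 U; have [c [c0 H]] := linear_gap tz e2 U.
exists (Num.min (c ^+ 2) (Num.min c 1)); split.
  by rewrite !lt_min c0 ltr01 exprn_gt0.
move=> q q0; rewrite !lt_min => /and3P[L1 L2 L3].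
have [h1 h2 h3] := qht_bound R q.
have hq1 : 1 <= (qht q)%:R :> R by rewrite ler1n qht_gt0.
have sq (x y : R) : `|x| <= y -> x ^+ 2 <= y ^+ 2.
  move=> xy; rewrite -[x ^+ 2]ger0_norm ?sqr_ge0 // normrX lerXn2r ?nnegrE //.
  exact: le_trans xy.
case: q q0 L1 L2 L3 h1 h2 h3 hq1 => [[cc b] a] q0 L1 L2 L3 /= h1 h2 h3 hq1.
have a0 : a != 0.
  apply/eqP => a0; have [b0|b0] := eqVneq b 0.
    have cc0 : cc != 0 by apply: contra q0; rewrite a0 b0 => /eqP ->.
    have : 1 <= `|qev z (cc, b, a)|.
      rewrite /qev /= a0 b0 !mul0r !addr0 -intr_norm (ler_int R 1) -gtz0_ge1 normr_gt0 //.
    have := exprn_ege1 2 hq1; move: L3; rewrite /=.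
    set u := `|_|; set w := _ ^+ 2; nra.
  have := H (- cc) b b0.
  have -> : b%:~R * z - (- cc)%:~R = qev z (cc, b, a).
    by rewrite /qev /= a0 mul0r addr0 rmorphN /= opprK addrC.
  move=> h; have := le_trans h (ler_wpM2l (normr_ge0 _) (sq _ _ h2)).
  by rewrite leNgt L2.
split=> // r; apply/negP => /eqP E.
set p := numq r; set d := denq r.
have d0 : 0 < d by apply: denq_gt0.
have dn0 : d != 0 by rewrite gt_eqF.
have cp : coprimez d p by rewrite coprimezE coprime_sym coprime_num_den.
have E' : a * p ^+ 2 + b * p * d + cc * d ^+ 2 = 0.
  apply: (@intr_inj rat); rewrite !(intrD, intrM, rmorphXn) /=.
  have -> : p%:~R = r * d%:~R :> rat by rewrite -[X in X * _](divq_num_den r) mulfVK // intr_eq0.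
  transitivity (d%:~R ^+ 2 * (cc%:~R + b%:~R * r + a%:~R * r ^+ 2)); first by ring.
  by rewrite E mulr0.
(* Gauss's lemma by hand: division by d T - p leaves the integral quotient s T + t. *)
have /dvdzP[s as_] : (d %| a)%Z.
  rewrite -(@Gauss_dvdzl _ _ (p ^+ 2)) ?coprimezXr //; apply/dvdzP.
  by exists (- (b * p + cc * d)); move: E'; lra.
have E2 : s * p ^+ 2 + b * p + cc * d = 0.
  apply: (mulfI dn0); rewrite mulr0 -[RHS]E' as_; ring.
have /dvdzP[t bt] : (d %| b + s * p)%Z.
  rewrite -(@Gauss_dvdzr _ p) //; apply/dvdzP; exists (- cc).
  by move: E2; lra.
have E3 : cc = - (p * t).
  apply: (mulfI dn0).
  have -> : d * - (p * t) = - (p * (t * d)) by ring.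
  by rewrite -bt; move: E2; lra.
have s0 : s != 0 by apply: contra a0; rewrite as_ => /eqP ->; rewrite mul0r.
have b2 : b = t * d - s * p by rewrite -bt; ring.
have EV : qev z (cc, b, a) = (d%:~R * z - p%:~R) * (s%:~R * z - (- t)%:~R).
  by rewrite /qev /= E3 b2 as_ !(intrD, intrM, rmorphN) /=; ring.
have H1 := H p d dn0; have H2 := H (- t) s s0.
have : c ^+ 2 <= `|qev z (cc, b, a)| * a%:~R ^+ 2.
  rewrite EV normrM as_ intrM expr2.
  set u := `|_|; set v := `|_|.
  have -> : u * v * (s%:~R * d%:~R) ^+ 2 = (u * d%:~R ^+ 2) * (v * s%:~R ^+ 2) by ring.
  by apply: ler_pM => //; apply: ltW.
move=> h; have := le_trans h (ler_wpM2l (normr_ge0 _) (sq _ _ h3)).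
by rewrite leNgt L1.
Qed.

(** * Cross products and resultants of two quadratics *)

Definition qcross (p q : quad) : quad :=
  (p.1.2 * q.2 - p.2 * q.1.2, p.2 * q.1.1 - p.1.1 * q.2, p.1.1 * q.1.2 - p.1.2 * q.1.1).

Definition qdot (w p : quad) : int := w.1.1 * p.1.1 + w.1.2 * p.1.2 + w.2 * p.2.

(** At [qcross p q] this is the resultant of p and q. *)
Definition qres (w : quad) : int := w.1.2 ^+ 2 - w.1.1 * w.2.

(** Together with [qerr2], this measures the distance of [w] from [w.1.1] times (1, z, z^2). *)
Definition qerr1 (R : realType) (z : R) (w : quad) : R := w.1.2%:~R - z * w.1.1%:~R.
Definition qerr2 (R : realType) (z : R) (w : quad) : R := w.2%:~R - z ^+ 2 * w.1.1%:~R.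

Lemma qerr1_cross (R : realType) (z : R) p q :
  qerr1 z (qcross p q) = p.2%:~R * qev z q - q.2%:~R * qev z p.
Proof. by rewrite /qerr1 /qcross /qev /= !(intrB, intrM); ring. Qed.

Lemma qerr2_cross (R : realType) (z : R) p q :
  qerr2 z (qcross p q) = q.1.2%:~R * qev z p - p.1.2%:~R * qev z q.
Proof. by rewrite /qerr2 /qcross /qev /= !(intrB, intrM); ring. Qed.

Lemma qerr_cross_bound (R : realType) (z : R) p q :
  `|qerr1 z (qcross p q)| <= (qht p)%:R * `|qev z q| + (qht q)%:R * `|qev z p| /\
  `|qerr2 z (qcross p q)| <= (qht p)%:R * `|qev z q| + (qht q)%:R * `|qev z p|.
Proof.
have [_ p2 p3] := qht_bound R p; have [_ q2 q3] := qht_bound R q.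
rewrite qerr1_cross qerr2_cross; split; apply: le_trans (ler_normB _ _) _.
  by rewrite !normrM lerD // ler_wpM2r.
by rewrite !normrM addrC lerD // ler_wpM2r.
Qed.

Lemma qcross0_bound (R : realType) p q :
  `|(qcross p q).1.1%:~R| <= 2 * (qht p)%:R * (qht q)%:R :> R.
Proof.
have [_ p2 p3] := qht_bound R p; have [_ q2 q3] := qht_bound R q.
rewrite /= intrB !intrM; apply: le_trans (ler_normB _ _) _; rewrite !normrM.
by rewrite -mulrA mulr_natl mulr2n lerD // ler_pM.
Qed.

Lemma qres_err (R : realType) (z : R) w :
  (qres w)%:~R = 2 * z * w.1.1%:~R * qerr1 z w + qerr1 z w ^+ 2 - w.1.1%:~R * qerr2 z w.
Proof. by rewrite /qres /qerr1 /qerr2 !(intrB, intrM, rmorphXn) /=; ring. Qed.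

Lemma qdot_cross_r p q : qdot (qcross p q) q = 0.
Proof. by rewrite /qdot /qcross /=; ring. Qed.

Lemma qdot_cross_l p q : qdot (qcross p q) p = 0.
Proof. by rewrite /qdot /qcross /=; ring. Qed.

(* If the resultant w1^2 - w0 w2 vanishes then w is proportional to (1, x, x^2)
   and w1 / w0 is a rational root of q. *)
Lemma qres_cross_neq0 p q : irr_quad q -> qcross p q != 0 -> qres (qcross p q) != 0.
Proof.
move=> [a0 nr]; set w := qcross p q => w0; apply/eqP => r0.
have D : qdot w q = 0 by apply: qdot_cross_r.
case: w w0 r0 D => [[x y] t]; rewrite /qres /qdot /= => w0 r0 D.
have [x0|x0] := eqVneq x 0.
  have y0 : y = 0 by move: r0; rewrite x0 mul0r subr0 => /eqP; rewrite expf_eq0 => /eqP.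
  have t0 : t != 0 by apply: contra w0; rewrite x0 y0 => /eqP ->.
  move: D; rewrite x0 y0 !mul0r !add0r => /eqP.
  by rewrite mulf_eq0 (negPf t0) (negPf a0).
have := nr (y%:~R / x%:~R); case/negP; apply/eqP.
have xq : (x%:~R : rat) != 0 by rewrite intr_eq0.
apply: (@mulfI _ (x%:~R ^+ 2)); first by rewrite expf_neq0.
rewrite mulr0.
transitivity ((x * (x * q.1.1 + y * q.1.2 + t * q.2) + (y ^+ 2 - x * t) * q.2)%:~R : rat).
  by rewrite !(intrD, intrM, intrN, rmorphXn) /=; field.
by rewrite D r0 mulr0 mul0r.
Qed.

(** A nonzero integer is at least 1 in absolute value. In [qres_err] the square of the error is at
    most 1 / 4, which leaves 3 / 4 for the terms linear in the errors. *)
Lemma qres_lower (R : realType) (z E : R) w : qres w != 0 ->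
  `|qerr1 z w| <= E -> `|qerr2 z w| <= E -> E <= 1 / 2 ->
  3 / 4 <= (2 * `|z| + 1) * (`|w.1.1%:~R| * E).
Proof.
move=> r0 e1 e2 E2.
have : 1 <= `|(qres w)%:~R : R| by rewrite -intr_norm (ler_int R 1) -gtz0_ge1 normr_gt0.
rewrite (qres_err z) => /le_trans-/(_ _ (ler_normB _ _)).
move=> /le_trans-/(_ _ (lerD (ler_normD _ _) (lexx _))).
rewrite !normrM [`|2|]ger0_norm //.
have := normr_ge0 z; have := normr_ge0 (w.1.1%:~R : R).
have := normr_ge0 (qerr1 z w); have := normr_ge0 (qerr2 z w).
set u := `|z|; set v := `|w.1.1%:~R|; set a := `|qerr1 z w| in e1 *; set b := `|qerr2 z w| in e2 *.
move=> b0 a0 v0 u0 H.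
have A1 : a * a <= 1 / 4 by nra.
have A2 : u * v * a <= u * v * E by apply: ler_wpM2l => //; apply: mulr_ge0.
have A3 : v * b <= v * E by apply: ler_wpM2l.
lra.
Qed.

Lemma qcross_parallel (w p q : quad) : qdot w p = 0 -> qdot w q = 0 ->
  (qcross p q).1.2 * w.1.1 = (qcross p q).1.1 * w.1.2 /\
  (qcross p q).2 * w.1.1 = (qcross p q).1.1 * w.2.
Proof.
case: w p q => [[w0 w1] w2] [[c b] a] [[c' b'] a']; rewrite /qdot /qcross /= => H1 H2.
split; apply/eqP; rewrite -subr_eq0; apply/eqP.
  transitivity (a * (w0 * c' + w1 * b' + w2 * a') - a' * (w0 * c + w1 * b + w2 * a)); first by ring.
  by rewrite H1 H2 !mulr0 subr0.
transitivity (b' * (w0 * c + w1 * b + w2 * a) - b * (w0 * c' + w1 * b' + w2 * a')); first by ring.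
by rewrite H1 H2 !mulr0 subr0.
Qed.

(** * Minimal polynomials of degree at most two *)

Lemma ln_le_pos (R : realType) (x y : R) : 0 < x -> x <= y -> ln x <= ln y.
Proof. by move=> x0 xy; rewrite ler_ln ?posrE // (lt_le_trans x0). Qed.

Lemma lnM_pos (R : realType) (x y : R) : 0 < x -> 0 < y -> ln (x * y) = ln x + ln y.
Proof. by move=> x0 y0; rewrite lnM ?posrE. Qed.

Lemma min_quad_exists (R : realType) (z : R) (K : nat) (S0 : quad) :
  S0 != 0 -> (qht S0 <= K)%N ->
  exists q, [/\ q != 0, (qht q <= K)%N
    & forall S, S != 0 -> (qht S <= K)%N -> `|qev z q| <= `|qev z S|].
Proof.
move=> S00 hS0.
(* Coefficients between -K and K are shifted to 0..2K, so that the minimum runs over a finite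
   type. *)
pose T := ('I_(K + K).+1 * 'I_(K + K).+1 * 'I_(K + K).+1)%type.
pose dec (t : T) : quad := (t.1.1%:Z - K%:Z, t.1.2%:Z - K%:Z, t.2%:Z - K%:Z).
pose en1 (x : int) : 'I_(K + K).+1 := inord (absz (x + K%:Z)).
pose enc (q : quad) : T := (en1 q.1.1, en1 q.1.2, en1 q.2).
have en1K (x : int) : (absz x <= K)%N -> (en1 x)%:Z - K%:Z = x.
  by move=> xK; rewrite /en1 inordK; lia.
have encK q : (qht q <= K)%N -> dec (enc q) = q.
  case: q => [[c b] a] hq; have := absz_qht (c, b, a) => /= -[h1 h2 h3].
  by rewrite /dec /enc /= !en1K //; apply: leq_trans hq.
have htd t : (qht (dec t) <= K)%N.
  case: t => [[x y] w]; rewrite /qht /dec /= !geq_max.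
  by have := ltn_ord x; have := ltn_ord y; have := ltn_ord w; lia.
have S0e : dec (enc S0) != 0 by rewrite encK.
case: (@arg_minP _ _ _ (enc S0) (fun t => dec t != 0) (fun t => `|qev z (dec t)|) S0e).
move=> t t0 tmin; exists (dec t); split=> // S S1 hS.
by rewrite -(encK S hS); apply: tmin; rewrite encK.
Qed.

(** The successive records of smallness at z: minimal points in the sense of Davenport and
    Schmidt. *)
Definition minimal_seq (R : realType) (z : R) (P : nat -> quad) : Prop :=
  [/\ forall i, P i != 0,
      forall i, (qht (P i) < qht (P i.+1))%N,
      forall i, `|qev z (P i.+1)| < `|qev z (P i)|
    & forall i q, q != 0 -> (qht q < qht (P i.+1))%N -> `|qev z (P i)| <= `|qev z q|].

(** Greedy construction: the next term minimises the value at z up to the least height at which the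
    present term is beaten. The uniform exponent ensures that it is beaten. *)
Lemma minimal_seq_exists (R : realType) (z eta : R) : transcendental z -> 0 < eta ->
  quad_uniform z eta -> exists P, minimal_seq z P.
Proof.
move=> tz eta0 [X0 [X01 HX]].
pose good q := q != 0 /\ forall S, S != 0 -> (qht S <= qht q)%N -> `|qev z q| <= `|qev z S|.
have step (q : quad) : good q -> exists q', [/\ good q', `|qev z q'| < `|qev z q|
    & forall S, S != 0 -> (qht S < qht q')%N -> `|qev z q| <= `|qev z S|].
  move=> [q0 gq]; have L0 : 0 < `|qev z q| by rewrite normr_gt0 qev_neq0.
  pose B K := `[< exists S, [/\ S != 0, (qht S <= K)%N & `|qev z S| < `|qev z q|] >].
  have exB : exists K, B K.
    have [X1 [X11 HX1]] : exists X0 : R, 1 <= X0 /\ forall X, X0 <= X ->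
        `|qev z q|^-1 * X `^ (- eta) < X `^ 0.
      by apply: powR_absorb_lt; rewrite oppr_lt0.
    have [S [S0 hS eS]] := HX (Num.max X0 X1) (ltac:(by rewrite le_max lexx)).
    exists (qht S); apply/asboolP; exists S; split=> //.
    have := HX1 (Num.max X0 X1) (ltac:(by rewrite le_max lexx orbT)).
    rewrite powRr0 mulrC ltr_pdivrMr // mul1r; exact: le_lt_trans.
  case: (ex_minnP exB) => K /asboolP[S [S0 hS eS]] Kmin.
  have [q' [q'0 hq' q'min]] := min_quad_exists z S0 hS.
  have eq' : `|qev z q'| < `|qev z q| by apply: le_lt_trans eS; apply: q'min.
  have BS S1 : S1 != 0 -> (qht S1 < K)%N -> `|qev z q| <= `|qev z S1|.
    move=> S10 hS1; rewrite leNgt; apply/negP => eS1.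
    have : B (qht S1) by apply/asboolP; exists S1.
    by move=> /Kmin; rewrite leqNgt hS1.
  exists q'; split=> //.
    by split=> // S1 S10 hS1; apply: q'min => //; apply: leq_trans hq'.
  by move=> S1 S10 hS1; apply: BS => //; apply: leq_trans hq'.
have [q1 [q10 hq1 q1m]] := @min_quad_exists R z 1 (1, 0, 0) isT isT.
have g1 : good q1.
  by split=> // S S0 hS; apply: q1m => //; apply: leq_trans hq1.
pose T := {q | good q}.
have [|f Hf] := @choice T T (fun t t' => `|qev z (sval t')| < `|qev z (sval t)| /\
    forall S, S != 0 -> (qht S < qht (sval t'))%N -> `|qev z (sval t)| <= `|qev z S|).
  by move=> [q gq]; have [q' [gq' e' m']] := step q gq; exists (exist _ q' gq').
pose P i := sval (iter i f (exist _ q1 g1)).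
have gP i : good (P i) by apply: svalP.
exists P; split=> [i|i|i|i]; first by case: (gP i).
- rewrite ltnNge; apply/negP => h; have [e _] := Hf (iter i f (exist _ q1 g1)).
  have [_ m] := gP i; have := m (P i.+1) (gP i.+1).1 h.
  by rewrite leNgt e.
- by have [e _] := Hf (iter i f (exist _ q1 g1)).
- by have [_] := Hf (iter i f (exist _ q1 g1)).
Qed.

Lemma minimal_seq_ht (R : realType) (z : R) P i j : minimal_seq z P ->
  (i < j)%N -> (qht (P i) < qht (P j))%N.
Proof. 
case=> _ h _ _; apply: (@homo_ltn _ (fun i => qht (P i)) (fun a b => (a < b)%N)) => //.
by move=> y x w; apply: ltn_trans.
 Qed.

Lemma minimal_seq_ht_le (R : realType) (z : R) P i j : minimal_seq z P ->
  (i <= j)%N -> (qht (P i) <= qht (P j))%N.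
Proof. by move=> mP; rewrite leq_eqVlt => /predU1P[->//|/(minimal_seq_ht mP)/ltnW]. Qed.

Lemma minimal_seq_ev (R : realType) (z : R) P i j : minimal_seq z P ->
  (i < j)%N -> `|qev z (P j)| < `|qev z (P i)|.
Proof.
case=> _ _ h _; apply: (@homo_ltn _ (fun i => `|qev z (P i)|) (fun x y => y < x)) => //.
by move=> y x w xy yw; apply: lt_trans xy.
Qed.

Lemma minimal_seq_ge (R : realType) (z : R) P i : minimal_seq z P -> (i <= qht (P i))%N.
Proof.
move=> [_ h _ _]; elim: i => // i IH; exact: leq_ltn_trans (h i).
Qed.

(** Proportional quadratics have their values at z and their heights in the same ratio, while along
    the sequence heights grow and values shrink. *)
Lemma minimal_seq_cross_neq0 (R : realType) (z : R) P i j : transcendental z ->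
  minimal_seq z P -> (i < j)%N -> irr_quad (P j) -> qcross (P i) (P j) != 0.
Proof.
move=> tz mP ij [aj0 _]; apply/eqP => C0.
have hij := minimal_seq_ht mP ij; have eij := minimal_seq_ev mP ij.
have Pi0 : P i != 0 by case: mP.
have ei := qev_neq0 tz Pi0.
move: C0 aj0 hij eij ei; case: (P i) => [[c1 b1] a1]; case: (P j) => [[c2 b2] a2].
rewrite /qcross /= => -[/eqP]; rewrite subr_eq0 => /eqP E1 /eqP.
rewrite subr_eq0 => /eqP E2 _ a20 hij eij ei.
have EV : qev z (c1, b1, a1) * a2%:~R = a1%:~R * qev z (c2, b2, a2).
  rewrite /qev /=.
  have E1' : b1%:~R * a2%:~R = a1%:~R * b2%:~R :> R by rewrite -!intrM E1.
  have E2' : a1%:~R * c2%:~R = c1%:~R * a2%:~R :> R by rewrite -!intrM E2.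
  rewrite !mulrDl !mulrDr E2' [b1%:~R * z * _]mulrAC E1' ; ring.
have a10 : a1 != 0.
  apply/eqP => a10; have Z : a1%:~R = 0 :> R by rewrite a10.
  move: EV; rewrite Z mul0r => /eqP.
  by rewrite mulf_eq0 (negPf ei) intr_eq0 (negPf a20).
have lt : (absz a2 < absz a1)%N.
  rewrite -(ltr_nat R) !natr_absz !intr_norm.
  rewrite -(@ltr_pM2l _ `|qev z (c1, b1, a1)|) ?normr_gt0 // -normrM EV normrM mulrC.
  by rewrite ltr_pM2r // normr_gt0 intr_eq0.
have F1 : (absz b1 * absz a2 = absz a1 * absz b2)%N by rewrite -!abszM E1.
have F2 : (absz a1 * absz c2 = absz c1 * absz a2)%N by rewrite -!abszM E2.
have [/= h1 h2 h3] := absz_qht (c1, b1, a1).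
move: h1 h2 h3 hij; move: (qht (c1, b1, a1)) => K h1 h2 h3 hij.
have : (absz a1 * qht (c2, b2, a2) <= absz a2 * K)%N.
  rewrite {1}/qht /= !maxnMr !geq_max F2 -F1 [(absz a1 * absz a2)%N]mulnC.
  by rewrite [(absz c1 * _)%N]mulnC [(absz b1 * _)%N]mulnC !leq_mul.
apply/negP; rewrite -ltnNge; apply: ltn_mul => //.
Qed.

(** * Growth of heights and values along the minimal sequence *)

Definition lnH (R : realType) (P : nat -> quad) i : R := ln (qht (P i))%:R.
Definition lnL (R : realType) (z : R) (P : nat -> quad) i : R := - ln `|qev z (P i)|.

Lemma lnH_infty (R : realType) (z : R) P (A : R) : minimal_seq z P ->
  exists i0, forall i, (i0 <= i)%N -> A <= lnH R P i.
Proof.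
move=> mP; exists (Num.truncn (expR A)).+1 => i hi.
rewrite -[A]expRK; apply: ln_le_pos; first exact: expR_gt0.
apply: (le_trans (ltW (truncnS_gt _))); rewrite ler_nat.
exact: leq_trans hi (minimal_seq_ge _ mP).
Qed.

Lemma lnL_ge (R : realType) (z eta : R) P : transcendental z -> 0 < eta ->
  quad_uniform z eta -> minimal_seq z P ->
  exists i0, forall i, (i0 <= i)%N -> eta * lnH R P i.+1 - eta * ln 2 <= lnL z P i.
Proof.
move=> tz eta0 [X0 [X01 HX]] mP.
exists (Num.truncn (2 * X0)).+1 => i hi.
have H0 : (0 : R) < (qht (P i.+1))%:R.
  by rewrite ltr0n; apply: leq_trans (minimal_seq_ge _ mP).
(* Half of the next height: a solution of height at most [X] is strictly below that height, so the
   minimality of [P i] applies. This costs [eta * ln 2]. *)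
pose X : R := (qht (P i.+1))%:R / 2.
have X0' : 0 < X by rewrite divr_gt0.
have [|q [q0 qX qe]] := HX X.
  rewrite /X ler_pdivlMr // mulrC; apply: (le_trans (ltW (truncnS_gt _))).
  by rewrite ler_nat; apply: leq_trans hi (leq_trans _ (minimal_seq_ge _ mP)).
have : `|qev z (P i)| <= X `^ (- eta).
  apply: le_trans qe; case: mP => _ _ _; apply => //.
  rewrite -(ltr_nat R); apply: le_lt_trans qX _; rewrite /X; lra.
move=> /ln_le_pos; rewrite normr_gt0 qev_neq0; last by case: mP.
  move=> /(_ isT); rewrite ln_powR /X ln_div ?posrE // /lnL /lnH; lra.
exact: tz.
Qed.

Lemma consecutive_small (R : realType) (z eta e : R) P : transcendental z -> 2 < eta ->
  quad_uniform z eta -> minimal_seq z P -> 0 < e ->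
  exists i0, forall i, (i0 <= i)%N -> 2 * (qht (P i.+1))%:R * `|qev z (P i)| <= e.
Proof.
move=> tz eta2 U mP e0; have eta0 : 0 < eta by lra.
have [i1 H1] := lnL_ge tz eta0 U mP.
have [i2 H2] := lnH_infty 0 mP.
have [i3 H3] := lnH_infty (eta * ln 2 + ln 2 - ln e) mP.
exists (i1 + i2 + i3) => i hi.
have q0 k : P k != 0 by case: mP.
have L0 k : 0 < `|qev z (P k)| by rewrite normr_gt0 qev_neq0.
have Hp k : (0 : R) < (qht (P k))%:R by rewrite ltr0n qht_gt0.
have A1 := H1 i ltac:(lia); have A2 := H2 i.+1 ltac:(lia).
have A3 := H3 i.+1 ltac:(lia).
rewrite -ler_ln ?posrE ?mulr_gt0 // !lnM_pos ?mulr_gt0 // -/(lnH R P i.+1).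
have M : lnH R P i.+1 <= (eta - 1) * lnH R P i.+1 by rewrite ler_peMl; lra.
by move: A1; rewrite /lnL; lra.
Qed.

Lemma minimal_seq_eventually (R : realType) (z eta : R) P : transcendental z -> 2 < eta ->
  quad_uniform z eta -> minimal_seq z P ->
  exists i0, forall i, (i0 <= i)%N ->
    [/\ irr_quad (P i), eta * lnH R P i.+1 - eta * ln 2 <= lnL z P i, 0 <= lnH R P i
      & 2 * (qht (P i.+1))%:R * `|qev z (P i)| <= 1 / 2].
Proof.
move=> tz eta2 U mP; have eta0 : 0 < eta by lra.
have [i1 H1] := lnL_ge tz eta0 U mP.
have [c [c0 Hc]] := irr_quad_of_small tz eta2 U.
have [i2 H2] := lnH_infty 0 mP.
(* Large enough for |P_i(z)| H_i^2 < c, as [irr_quad_of_small] requires. *)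
have [i3 H3] := lnH_infty ((eta * ln 2 - ln c + 1) / (eta - 2)) mP.
have [i4 H4] := consecutive_small tz eta2 U mP (ltac:(lra) : 0 < 1 / 2 :> R).
exists (i1 + i2 + i3 + i4).+1 => i hi.
have q0 k : P k != 0 by case: mP.
have L0 k : 0 < `|qev z (P k)| by rewrite normr_gt0 qev_neq0.
have Hp k : (0 : R) < (qht (P k))%:R by rewrite ltr0n qht_gt0.
have mono : lnH R P i <= lnH R P i.+1.
  by apply: ln_le_pos => //; rewrite ler_nat (minimal_seq_ht_le mP).
have A1 := H1 i ltac:(lia); have A2 := H2 i ltac:(lia).
have A3 := H3 i ltac:(lia); have A4 := H4 i ltac:(lia).
split=> //.
  apply: Hc => //; rewrite -ltr_ln ?posrE ?mulr_gt0 ?exprn_gt0 //.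
  rewrite lnM_pos ?exprn_gt0 // lnXn // -/(lnH R P i).
  move: A3; rewrite ler_pdivrMr ?subr_gt0 // => A3.
  have M : eta * lnH R P i <= eta * lnH R P i.+1 by rewrite ler_pM2l.
  by move: A1; rewrite /lnL mulr2n; lra.
Qed.

(** The determinant of three consecutive terms. The index is that of the first one, so the middle
    polynomial of the turn is [P i.+1]. *)
Definition turn (P : nat -> quad) i : Prop :=
  qdot (qcross (P i.+1) (P i.+2)) (P i) != 0.

(** The determinant is a nonzero integer. Trading one column for the values at z bounds it by 6
    H_(i+1) H_(i+2) |P_i(z)|. *)
Lemma turn_lnH (R : realType) (z : R) P i : transcendental z -> minimal_seq z P ->
  turn P i -> lnL z P i - ln 6 <= lnH R P i.+1 + lnH R P i.+2.
Proof.
move=> tz mP ti; have q0 k : P k != 0 by case: mP.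
have L0 k : 0 < `|qev z (P k)| by rewrite normr_gt0 qev_neq0.
have Hp k : (0 : R) < (qht (P k))%:R by rewrite ltr0n qht_gt0.
suff : 1 <= 6 * (qht (P i.+1))%:R * (qht (P i.+2))%:R * `|qev z (P i)|.
  move=> /(ln_le_pos ltr01); rewrite ln1 !lnM_pos ?mulr_gt0 // /lnL /lnH; lra.
have : 1 <= `|(qdot (qcross (P i.+1) (P i.+2)) (P i))%:~R : R|.
  by rewrite -intr_norm (ler_int R 1) -gtz0_ge1 normr_gt0.
set w := qcross _ _; have [e1 e2] := qerr_cross_bound z (P i.+1) (P i.+2).
have w0 := qcross0_bound R (P i.+1) (P i.+2); rewrite -/w in e1 e2 w0.
have -> : (qdot w (P i))%:~R = w.1.1%:~R * qev z (P i) + qerr1 z w * (P i).1.2%:~R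
    + qerr2 z w * (P i).2%:~R.
  by rewrite /qdot /qev /qerr1 /qerr2 !(intrD, intrM); ring.
move=> /le_trans-/(_ _ (ler_normD _ _)) /le_trans-/(_ _ (lerD (ler_normD _ _) (lexx _))).
rewrite !normrM.
have [_ h2 h3] := qht_bound R (P i).
have l1 := ltW (minimal_seq_ev mP (ltnSn i)).
have l2 := ltW (lt_trans (minimal_seq_ev mP (ltnSn i.+1)) (minimal_seq_ev mP (ltnSn i))).
have m1 : (qht (P i))%:R <= (qht (P i.+1))%:R :> R by rewrite ler_nat (minimal_seq_ht_le mP).
have m2 : (qht (P i.+1))%:R <= (qht (P i.+2))%:R :> R by rewrite ler_nat (minimal_seq_ht_le mP).
have := Hp i; have := Hp i.+1; have := Hp i.+2; have := L0 i.
set H := (qht (P i))%:R in h2 h3 m1 *; set H1 := (qht (P i.+1))%:R in e1 e2 w0 m1 m2 *.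
set H2 := (qht (P i.+2))%:R in e1 e2 w0 m2 *; set L := `|qev z (P i)| in l1 l2 *.
move=> Lp H2p H1p Hp0 D.
have E : H1 * `|qev z (P i.+2)| + H2 * `|qev z (P i.+1)| <= 2 * (H2 * L).
  rewrite mulr_natl mulr2n; apply: lerD; last by rewrite ler_pM2l.
  by apply: ler_pM => //; exact: ltW.
have B1 : `|w.1.1%:~R| * L <= 2 * H1 * H2 * L by rewrite ler_pM2r.
have B2 : `|qerr1 z w| * `|(P i).1.2%:~R| <= 2 * (H2 * L) * H1.
  by apply: ler_pM => //; [exact: le_trans e1 E|exact: le_trans h2 m1].
have B3 : `|qerr2 z w| * `|(P i).2%:~R| <= 2 * (H2 * L) * H1.
  by apply: ler_pM => //; [exact: le_trans e2 E|exact: le_trans h3 m1].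
lra.
Qed.

Lemma qerr_parallel (R : realType) (z : R) (w n : quad) :
  w.1.2 * n.1.1 = w.1.1 * n.1.2 -> w.2 * n.1.1 = w.1.1 * n.2 ->
  qerr1 z w * n.1.1%:~R = w.1.1%:~R * qerr1 z n /\
  qerr2 z w * n.1.1%:~R = w.1.1%:~R * qerr2 z n.
Proof.
move=> h1 h2; have h1' : w.1.2%:~R * n.1.1%:~R = w.1.1%:~R * n.1.2%:~R :> R by rewrite -!intrM h1.
have h2' : w.2%:~R * n.1.1%:~R = w.1.1%:~R * n.2%:~R :> R by rewrite -!intrM h2.
by rewrite /qerr1 /qerr2 !mulrBl !mulrBr h1' h2'; split; ring.
Qed.

Lemma qerr_consecutive (R : realType) (z : R) P i : minimal_seq z P ->
  `|qerr1 z (qcross (P i) (P i.+1))| <= 2 * (qht (P i.+1))%:R * `|qev z (P i)| /\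
  `|qerr2 z (qcross (P i) (P i.+1))| <= 2 * (qht (P i.+1))%:R * `|qev z (P i)|.
Proof.
move=> mP; have [e1 e2] := qerr_cross_bound z (P i) (P i.+1).
suff B : (qht (P i))%:R * `|qev z (P i.+1)| + (qht (P i.+1))%:R * `|qev z (P i)|
    <= 2 * (qht (P i.+1))%:R * `|qev z (P i)|.
  by split; [exact: le_trans e1 B|exact: le_trans e2 B].
rewrite -[leRHS]mulrA [leRHS]mulr_natl mulr2n lerD2r; apply: ler_pM => //.
  by rewrite ler_nat (minimal_seq_ht_le mP).
exact/ltW/(minimal_seq_ev mP).
Qed.

Lemma consecutive_lower (R : realType) (z : R) P i : transcendental z ->
  minimal_seq z P -> irr_quad (P i.+1) -> 2 * (qht (P i.+1))%:R * `|qev z (P i)| <= 1 / 2 ->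
  3 / 4 <= (2 * `|z| + 1) * (`|(qcross (P i) (P i.+1)).1.1%:~R|
    * (2 * (qht (P i.+1))%:R * `|qev z (P i)|)).
Proof.
move=> tz mP ir E2; have [e1 e2] := qerr_consecutive i mP.
apply: qres_lower => //; apply: qres_cross_neq0 => //.
exact: minimal_seq_cross_neq0 tz mP (ltnSn i) ir.
Qed.

Lemma consecutive_cross0_neq0 (R : realType) (z : R) P i : transcendental z ->
  minimal_seq z P -> irr_quad (P i.+1) -> 2 * (qht (P i.+1))%:R * `|qev z (P i)| <= 1 / 2 ->
  (qcross (P i) (P i.+1)).1.1 != 0.
Proof.
move=> tz mP ir E2; apply/eqP => n0; have := consecutive_lower tz mP ir E2.
by rewrite n0 normr0 mul0r mulr0; lra.
Qed.

(* The planes spanned by consecutive minimal polynomials cannot stay constant: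
   the normal vectors of one fixed plane are proportional, while their errors
   tend to 0. *)
Lemma leave_plane (R : realType) (z eta : R) P i0 : transcendental z -> 2 < eta ->
  quad_uniform z eta -> minimal_seq z P ->
  (forall i, (i0 <= i)%N -> irr_quad (P i) /\ 2 * (qht (P i.+1))%:R * `|qev z (P i)| <= 1 / 2) ->
  exists i1, forall i, (i1 <= i)%N -> exists m,
    (i0 <= m < i)%N /\ qdot (qcross (P i) (P i.+1)) (P m) != 0.
Proof.
move=> tz eta2 U mP reg.
set w := qcross (P i0) (P i0.+1).
have r0 : qres w != 0.
  have [ir _] := reg i0.+1 (leqnSn _); apply: qres_cross_neq0 => //.
  exact: minimal_seq_cross_neq0 tz mP (ltnSn _) ir.
set W : R := `|w.1.1%:~R| + 1; have W0 : 0 < W by rewrite ltr_wpDl.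
have key (e : R) : e != 0 -> exists i1, forall i, (i1 <= i)%N ->
    `|w.1.1%:~R| * (2 * (qht (P i.+1))%:R * `|qev z (P i)|) < `|e|.
  move=> e0; have e0' : 0 < `|e| by rewrite normr_gt0.
  have [i1 H] := consecutive_small tz eta2 U mP (divr_gt0 e0' W0).
  exists i1 => i /H h; apply: (@le_lt_trans _ _ (`|w.1.1%:~R| * (`|e| / W))).
    exact: ler_wpM2l.
  rewrite mulrCA -[ltRHS]mulr1 ltr_pM2l // ltr_pdivrMr // mul1r /W; lra.
have [i1 Hi1] : exists i1, forall i, (i1 <= i)%N ->
    let E := `|w.1.1%:~R| * (2 * (qht (P i.+1))%:R * `|qev z (P i)|) in
    E < `|qerr1 z w| \/ E < `|qerr2 z w|.
  have [e1|e1] := eqVneq (qerr1 z w) 0; last first.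
    by have [i1 H] := key _ e1; exists i1 => i /H; left.
  have [e2|e2] := eqVneq (qerr2 z w) 0; last first.
    by have [i1 H] := key _ e2; exists i1 => i /H; right.
  have := qres_err z w; rewrite e1 e2 !mulr0 expr0n /= subr0 addr0 => /eqP.
  by rewrite intr_eq0 (negPf r0).
exists (i0 + i1).+2 => i hi; apply: contrapT => /forallNP H.
have perp m : (i0 <= m < i)%N -> qdot (qcross (P i) (P i.+1)) (P m) = 0.
  by move=> hm; apply/eqP; apply: contra_notT (H m).
have [ir _] := reg i.+1 ltac:(lia); have [_ sm] := reg i ltac:(lia).
have n0 := consecutive_cross0_neq0 tz mP ir sm.
have [p1 p2] := qcross_parallel (perp i0 ltac:(lia)) (perp i0.+1 ltac:(lia)).
have [q1 q2] := qerr_parallel z p1 p2; rewrite -/w in q1 q2.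
have [e1 e2] := qerr_consecutive i mP.
have n1 : 1 <= `|(qcross (P i) (P i.+1)).1.1%:~R : R|.
  by rewrite -intr_norm (ler_int R 1) -gtz0_ge1 normr_gt0.
set n := qcross (P i) (P i.+1) in q1 q2 e1 e2 n1.
have B (x y : R) : x * n.1.1%:~R = w.1.1%:~R * y ->
    `|y| <= 2 * (qht (P i.+1))%:R * `|qev z (P i)| ->
    `|x| <= `|w.1.1%:~R| * (2 * (qht (P i.+1))%:R * `|qev z (P i)|).
  move=> E hy; apply: (@le_trans _ _ (`|x| * `|n.1.1%:~R|)); first by rewrite ler_peMr.
  by rewrite -normrM E normrM ler_wpM2l.
have [] := Hi1 i ltac:(lia); rewrite ltNge.
  by rewrite (B _ _ q1 e1).
by rewrite (B _ _ q2 e2).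
Qed.

Lemma qdot_parallel (w n p : quad) :
  w.1.2 * n.1.1 = w.1.1 * n.1.2 -> w.2 * n.1.1 = w.1.1 * n.2 ->
  qdot w p * n.1.1 = w.1.1 * qdot n p.
Proof.
case: w n p => [[w0 w1] w2] [[n0 n1] n2] [[c b] a]; rewrite /qdot /= => h1 h2.
rewrite !mulrDl !mulrDr; congr (_ + _ + _); first by ring.
  by rewrite mulrAC h1 mulrA.
by rewrite mulrAC h2 mulrA.
Qed.

(** If [P m] is the last term before [P i] outside the plane of [P i] and [P i.+1], the two terms
    after it lie in that plane and span it, so the three are independent. *)
Lemma previous_turn (R : realType) (z eta : R) P i0 : transcendental z -> 2 < eta ->
  quad_uniform z eta -> minimal_seq z P ->
  (forall i, (i0 <= i)%N -> irr_quad (P i) /\ 2 * (qht (P i.+1))%:R * `|qev z (P i)| <= 1 / 2) ->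
  exists i1, forall i, (i1 <= i)%N -> exists m,
    [/\ (i0 <= m < i)%N, turn P m & qdot (qcross (P i) (P i.+1)) (P m.+1) = 0].
Proof.
move=> tz eta2 U mP reg; have [i1 H] := leave_plane tz eta2 U mP reg.
exists (i0 + i1) => i hi; set n := qcross _ _.
pose B m := (i0 <= m < i)%N && (qdot n (P m) != 0).
have exB : exists m, B m.
  by have [m [h1 h2]] := H i ltac:(lia); exists m; rewrite /B h1.
have ubB m : B m -> (m <= i)%N by move=> /andP[/andP[_ /ltnW]].
case: (ex_maxnP exB ubB) => m /andP[hm nm] mmax.
have perp k : (m < k <= i.+1)%N -> qdot n (P k) = 0.
  move=> /andP[mk]; rewrite leq_eqVlt => /predU1P[->|]; first exact: qdot_cross_r.
  rewrite ltnS leq_eqVlt => /predU1P[->|ki]; first exact: qdot_cross_l.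
  apply/eqP/negP => /negP nk; have : B k by rewrite /B nk andbT; lia.
  by move=> /mmax; rewrite leqNgt mk.
have p1 := perp m.+1 ltac:(lia); have p2 := perp m.+2 ltac:(lia).
exists m; split=> //; rewrite /turn.
have [c1 c2] := qcross_parallel p1 p2.
have [ir _] := reg m.+2 ltac:(lia); have [_ sm] := reg m.+1 ltac:(lia).
have w0 := consecutive_cross0_neq0 tz mP ir sm.
set w := qcross _ _ in c1 c2 w0 *.
apply/eqP => D; have : w.1.1 * qdot n (P m) = 0.
  have <- : qdot w (P m) * n.1.1 = w.1.1 * qdot n (P m).
    exact: qdot_parallel.
  by rewrite D mul0r.
by move/eqP; rewrite mulf_eq0 (negPf w0) (negPf nm).
Qed.

(* Comparing the resultants of (P_i, P_(i+1)) and (P_j, P_(i+1)), whose cross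
   products are proportional, bounds H_(i+1) in terms of H_j. *)
Lemma same_plane_lower (R : realType) (z : R) P i j : transcendental z ->
  minimal_seq z P -> irr_quad (P i.+1) -> 2 * (qht (P i.+1))%:R * `|qev z (P i)| <= 1 / 2 ->
  (j <= i)%N -> qdot (qcross (P i) (P i.+1)) (P j) = 0 ->
  (4 * (2 * `|z| + 1))^-1 <=
    (qht (P j))%:R * (qht (P i.+1))%:R * (2 * (qht (P i.+1))%:R * `|qev z (P i)|).
Proof.
move=> tz mP ir E2 ji D; have low := consecutive_lower tz mP ir E2.
have n0 := consecutive_cross0_neq0 tz mP ir E2.
have [e1 e2] := qerr_consecutive i mP.
set E := 2 * _ * _ in E2 low e1 e2 *; set n := qcross (P i) (P i.+1) in D low n0 e1 e2.
have [p1 p2] := qcross_parallel D (qdot_cross_r (P i) (P i.+1)).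
have [q1 q2] := qerr_parallel z p1 p2.
have wb := qcross0_bound R (P j) (P i.+1).
have wr : qres (qcross (P j) (P i.+1)) != 0.
  by apply: qres_cross_neq0 => //; apply: minimal_seq_cross_neq0 tz mP _ ir; rewrite ltnS.
set w := qcross (P j) (P i.+1) in p1 p2 q1 q2 wb wr.
have N0 : 0 < `|n.1.1%:~R : R| by rewrite normr_gt0 intr_eq0.
have E0 : 0 <= E by rewrite !mulr_ge0.
rewrite -/n in q1 q2; set N := `|n.1.1%:~R| in low N0; set W := `|w.1.1%:~R : R| in wb.
set Z := 2 * `|z| + 1 in low *; have Z1 : 1 <= Z by rewrite /Z; have := normr_ge0 z; lra.
have W0 : 0 <= W by apply: normr_ge0.
rewrite leNgt; apply/negP => hlt.
set T := (qht (P j))%:R * (qht (P i.+1))%:R in hlt.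
have Z4 : 0 < 4 * Z by lra.
have TE : 4 * Z * (T * E) < 1 by rewrite mulrC -ltr_pdivlMr // mul1r.
have WT : W <= 2 * T by rewrite /T mulrA.
have WE : Z * (W * E) <= 1 / 2.
  have : Z * (W * E) <= Z * (2 * T * E) by rewrite ler_wpM2l ?ler_wpM2r //; lra.
  lra.
(* The normals [w] and [n] are proportional, so the errors of [w] are W / N times those of [n].
   Under the hypothesis to be refuted, the lower bound for [n] makes this ratio at most 2 / 3, and
   the errors of [w] become too small for a nonzero resultant. *)
pose E' := W * E / N.
have E'b : E' <= 2 / 3 * E.
  rewrite /E' ler_pdivrMr //.
  have : W * E * (3 / 4) <= W * E * (Z * (N * E)) by rewrite ler_wpM2l // mulr_ge0.
  have : Z * (W * E) * (N * E) <= 1 / 2 * (N * E) by rewrite ler_wpM2r // mulr_ge0 ?(ltW N0).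
  lra.
have B (x y : R) : x * n.1.1%:~R = w.1.1%:~R * y -> `|y| <= E -> `|x| <= E'.
  by move=> h hy; rewrite /E' ler_pdivlMr // -normrM h normrM ler_wpM2l.
have := qres_lower wr (B _ _ q1 e1) (B _ _ q2 e2); rewrite -/W -/Z => /(_ ltac:(lra)).
have : W * E' <= W * (2 / 3 * E) by rewrite ler_wpM2l.
nra.
Qed.

(** The choice runs from the top: [i] is so large that its preceding turn [m] passes the threshold
    beyond which [m] has a preceding turn [k] at or after [i0]. *)
Lemma three_turns P i0 a0 :
  (forall j0, (i0 <= j0)%N -> exists i1, forall i, (i1 <= i)%N -> exists m,
    [/\ (j0 <= m < i)%N, turn P m & qdot (qcross (P i) (P i.+1)) (P m.+1) = 0]) ->
  exists i m k,
    [/\ [/\ (i0 <= k)%N, (k < m)%N, (m < i)%N & (a0 <= i)%N],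
        [/\ turn P i, turn P m & turn P k],
        qdot (qcross (P i) (P i.+1)) (P m.+1) = 0
      & qdot (qcross (P m) (P m.+1)) (P k.+1) = 0].
Proof.
move=> prev; have [i1 H1] := prev i0 (leqnn _).
have [i2 H2] := prev (i0 + i1)%N (leq_addr _ _).
have [i3 H3] := prev (i0 + i2 + a0)%N ltac:(lia).
have [i [hi ti _]] := H3 i3 (leqnn _).
have [m [hm tm dm]] := H2 i ltac:(lia).
have [k [hk tk dk]] := H1 m ltac:(lia).
by exists i, m, k; split=> //; split; lia.
Qed.

(** The quadratics are the middle terms of three turns k < m < i. For eta = g^2 the factors eta - 1,
    eta - 2 and eta (eta - 1) are g, 1 / g and g^3, so the upper and lower bounds between
    neighbouring heights meet at the exponent g. *)
Lemma good_triple (R : realType) (z eta : R) : transcendental z -> 2 < eta ->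
  quad_uniform z eta ->
  exists K : R, 0 <= K /\ forall A : R, exists Q Q' Q'' : quad,
    [/\ irr_quad Q, Q' != 0, Q'' != 0, qcross Q' Q != 0 & qcross Q'' Q != 0] /\
    exists h h' h'' : R,
    [/\ [/\ h = ln (qht Q)%:R, h' = ln (qht Q')%:R & h'' = ln (qht Q'')%:R],
        [/\ A <= h, 0 <= h' & 0 <= h''],
        (eta - 1) * h' - K <= h /\ (eta - 1) * h'' - K <= h',
        (eta - 2) * h - K <= h' /\ (eta - 2) * h' - K <= h''
      & [/\ eta * (eta - 1) * h - K <= - ln `|qev z Q|,
            eta * (eta - 1) * h' - K <= - ln `|qev z Q'|
          & eta * (eta - 1) * h'' - K <= - ln `|qev z Q''| ] ].
Proof.
move=> tz eta2 U; have eta0 : 0 < eta by lra.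
have [P mP] := minimal_seq_exists tz eta0 U.
have q0 k : P k != 0 by case: mP.
have L0 k : 0 < `|qev z (P k)| by rewrite normr_gt0 qev_neq0.
have Hp k : (0 : R) < (qht (P k))%:R by rewrite ltr0n qht_gt0.
have [i0 reg] := minimal_seq_eventually tz eta2 U mP.
have ln2 : 0 <= ln 2 :> R by rewrite ln_ge0 ?ler1n.
have ln6 : 0 <= ln 6 :> R by rewrite ln_ge0 ?ler1n.
have [Z ZE] : exists Z : R, Z = 4 * (2 * `|z| + 1) by eexists.
have Z1 : 1 <= Z by rewrite ZE; have := normr_ge0 z; lra.
have lnZ : 0 <= ln Z by rewrite ln_ge0.
pose K1 : R := eta * ln 2 + ln 6.
have K10 : 0 <= K1 by rewrite addr_ge0 ?mulr_ge0 // ltW.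
pose K : R := (eta + 1) * K1 + eta * ln 2 + ln 2 + ln Z.
have e2 : 0 <= eta * ln 2 by rewrite mulr_ge0 // ltW.
have eK1 : 0 <= eta * K1 by rewrite mulr_ge0 // ltW.
(* In logarithms and up to constants, [lnL z P i] is at least eta times the height of [P i.+1], and
   at a turn at most the sum of the heights of [P i.+1] and [P i.+2]. The second claim uses the
   uniform exponent once more, at [i.+1]. *)
have step i : (i0 <= i)%N -> turn P i ->
    (eta - 1) * lnH R P i.+1 - K1 <= lnH R P i.+2 /\
    eta * (eta - 1) * lnH R P i.+1 - K <= lnL z P i.+1.
  move=> hi ti; have [_ l1 _ _] := reg i hi.
  have [_ l2 _ _] := reg i.+1 (leqW hi).
  have t1 := turn_lnH tz mP ti.
  have A1 : (eta - 1) * lnH R P i.+1 - K1 <= lnH R P i.+2 by rewrite /K1; lra.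
  split=> //; have : eta * ((eta - 1) * lnH R P i.+1 - K1) <= eta * lnH R P i.+2 by rewrite ler_pM2l.
  by rewrite /K; lra.
(* [same_plane_lower] bounds H_j H_(i+1)^2 |P_i(z)| from below, and |P_i(z)| is at most about
   H_(i+1)^(- eta). *)
have up i j : (i0 <= i)%N -> (j <= i)%N -> qdot (qcross (P i) (P i.+1)) (P j) = 0 ->
    (eta - 2) * lnH R P i.+1 - K <= lnH R P j.
  move=> hi ji D; have [_ l1 _ s1] := reg i hi; have [ir _ _ _] := reg i.+1 (leqW hi).
  have := same_plane_lower tz mP ir s1 ji D; rewrite -ZE => /ln_le_pos.
  rewrite invr_gt0 (lt_le_trans ltr01 Z1) => /(_ isT).
  rewrite lnV ?posrE ?(lt_le_trans ltr01 Z1) // !lnM_pos ?mulr_gt0 //.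
  by move: l1; rewrite /lnL /lnH /K; lra.
have down m i : (i0 <= m)%N -> (m < i)%N -> turn P m ->
    (eta - 1) * lnH R P m.+1 - K <= lnH R P i.+1.
  move=> hm mi tm; have [A _] := step m hm tm.
  have : lnH R P m.+2 <= lnH R P i.+1.
    by apply: ln_le_pos => //; rewrite ler_nat (minimal_seq_ht_le mP).
  by rewrite /K; lra.
have prev j0 : (i0 <= j0)%N -> exists i1, forall i, (i1 <= i)%N -> exists m,
    [/\ (j0 <= m < i)%N, turn P m & qdot (qcross (P i) (P i.+1)) (P m.+1) = 0].
  move=> h0; apply: (previous_turn tz eta2 U mP) => i hi.
  by have [] := reg i (leq_trans h0 hi).
exists K; split; first by rewrite /K; lra.
move=> A; have [a0 HA] := lnH_infty A mP.
have [i [m [k [[hk km mi ai] [ti tm tk] dm dk]]]] := three_turns a0 prev.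
have im : (i0 <= m)%N := leq_trans hk (ltnW km).
have ii : (i0 <= i)%N := leq_trans im (ltnW mi).
have [ir _ h0 _] := reg i.+1 (leqW ii).
have [_ _ hm0 _] := reg m.+1 (leqW im).
have [_ _ hk0 _] := reg k.+1 (leqW hk).
exists (P i.+1), (P m.+1), (P k.+1); split.
  split=> //; apply: (minimal_seq_cross_neq0 tz mP) => //.
  exact: ltn_trans km mi.
exists (lnH R P i.+1), (lnH R P m.+1), (lnH R P k.+1); split=> //.
- by split=> //; apply: HA; apply: leqW.
- by split; apply: down.
- by split; apply: up.
by split; [have [] := step i ii ti|have [] := step m im tm|have [] := step k hk tk].
Qed.

(** Put g = (1 + sqrt 5) / 2 and a = eta - 1 = g - e. Up to constants, h' + h'' lies between a (a -
    1) h and (1 / a + 1 / a^2) h, and both factors are 1 at e = 0 because g^2 = g + 1. The factor 1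
    + 2 e in [x] pays for the loss in the upper bound. *)
Lemma exponent_estimate (R : realType) (d : R) : 0 < d ->
  exists e : R, 0 < e /\ e <= 1 / 100 /\ forall K : R, 0 <= K ->
  let eta := (3 + Num.sqrt 5) / 2 - e in exists A : R, 0 <= A /\
  forall h h' h'' l l' l'' : R, A <= h -> 0 <= h' -> 0 <= h'' ->
    (eta - 1) * h' - K <= h -> (eta - 1) * h'' - K <= h' ->
    (eta - 2) * h - K <= h' -> (eta - 2) * h' - K <= h'' ->
    eta * (eta - 1) * h - K <= l -> eta * (eta - 1) * h' - K <= l' ->
    eta * (eta - 1) * h'' - K <= l'' ->
    let x := (1 + 2 * e) * h in
    [/\ K + h' + h'' <= x, (2 + Num.sqrt 5 - d) * x <= l - K
      & (2 + Num.sqrt 5 - d) * x <= l' + l''].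
Proof.
(* The condition 40 e <= d covers all the losses collected below. *)
move=> d0; pose e : R := Num.min (d / 40) (1 / 100).
have e0 : 0 < e by rewrite lt_min; apply/andP; split; lra.
have e1 : e <= 1 / 100 by rewrite /e ge_min lexx orbT.
have ed : 40 * e <= d.
  by have : e <= d / 40 by [rewrite /e ge_min lexx]; lra.
exists e; do 2 split=> //; move=> K K0 /=.
have s5 : Num.sqrt 5 ^+ 2 = 5 :> R by rewrite sqr_sqrtr.
have s0 : 0 <= Num.sqrt 5 :> R by apply: sqrtr_ge0.
move: (Num.sqrt 5) s5 s0 => s s5 s0.
have sl : 22 / 10 <= s by nra.
have su : s <= 224 / 100 by nra.
pose g := (1 + s) / 2; have gE : g ^+ 2 = g + 1 by rewrite /g; lra.
have g1 : 16 / 10 <= g by rewrite /g; lra.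
have g2 : g <= 162 / 100 by rewrite /g; lra.
have -> : 2 + s = 2 * g + 1 by rewrite /g; field.
have -> : (3 + s) / 2 - e = g + 1 - e by rewrite /g; field.
move: g gE g1 g2 => {s s5 s0 sl su} g gE g1 g2.
pose a := g - e.
have -> : g + 1 - e - 1 = a by rewrite /a; ring.
have -> : g + 1 - e - 2 = a - 1 by rewrite /a; ring.
have -> : g + 1 - e = a + 1 by rewrite /a; ring.
have a1 : 15 / 10 <= a by rewrite /a; lra.
have a2 : a <= 162 / 100 by rewrite /a; lra.
have a0 : 0 <= a by lra.
have ap : 0 < a by lra.
have q0 : 0 <= (a + 1) * a by rewrite mulr_ge0 // addr_ge0.
(* At e = 0 this is the equality g + 1 = g^2. The summand 2 e on the left is the room for the
   multiples of [K] in K + h' + h'' <= x. *)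
have F1 : a + 1 + 2 * e <= a ^+ 2 * (1 + 2 * e).
  have -> : a ^+ 2 = g + 1 - 2 * g * e + e ^+ 2 by rewrite /a sqrrB gE; ring.
  rewrite {1}/a.
  have E3 : 0 <= e ^+ 3 by rewrite exprn_ge0 // ltW.
  have ge2 : g * e ^+ 2 <= 162 / 100 * (1 / 100) * e.
    have : g * e <= 162 / 100 * e by rewrite ler_pM2r.
    have : g * e * e <= g * e * (1 / 100) by rewrite ler_pM2l // mulr_gt0 //; lra.
    by lra.
  have : 0 <= e ^+ 2 by rewrite sqr_ge0.
  lra.
(* [F2] and [F3] are first-order estimates in [e] of a (a - 1), equal to 1 at e = 0, and of (a + 1)
   a, equal to g^3 = 2 g + 1 at e = 0. *)
have F2 : 1 - 23 / 10 * e <= a * (a - 1).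
  have -> : a * (a - 1) = g ^+ 2 - g - (2 * g - 1) * e + e ^+ 2 by rewrite /a; ring.
  rewrite gE; have : (2 * g - 1) * e <= 224 / 100 * e by rewrite ler_pM2r //; lra.
  have : 0 <= e ^+ 2 by rewrite sqr_ge0.
  lra.
have F3 : 2 * g + 1 - 43 / 10 * e <= (a + 1) * a.
  have -> : (a + 1) * a = g ^+ 2 + g - (2 * g + 1) * e + e ^+ 2 by rewrite /a; ring.
  rewrite gE; have : (2 * g + 1) * e <= 424 / 100 * e by rewrite ler_pM2r //; lra.
  have : 0 <= e ^+ 2 by rewrite sqr_ge0.
  lra.
have F4 : (a + 1) * a <= 43 / 10 by nra.
have F6 : a ^+ 2 <= 263 / 100 by nra.
have F5 : 2 * g + 1 - 15 * e <= (a + 1) * a * (a * (a - 1)).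
  have u1 : 0 <= 1 - 23 / 10 * e by lra.
  apply: (@le_trans _ _ ((2 * g + 1 - 43 / 10 * e) * (1 - 23 / 10 * e))).
    have : g * e <= 162 / 100 * e by rewrite ler_pM2r.
    have : 0 <= e ^+ 2 by rewrite sqr_ge0.
    lra.
  by apply: ler_pM => //; lra.
have KA : 0 <= 20 * K / e by apply: divr_ge0; [apply: mulr_ge0|apply: ltW].
(* From this [A] on, 20 K <= e h, so additive constants cost only a multiple of e h. *)
exists (20 * K / e); split=> //.
move=> h h' h'' l l' l'' hA h'0 h''0 A1 A2 B1 B2 L1 L2 L3.
have eh : 20 * K <= e * h by rewrite [leRHS]mulrC -ler_pdivrMr.
have h0 : 0 <= h by exact: le_trans KA hA.
have G : (2 * g + 1 - d) * ((1 + 2 * e) * h) <= (2 * g + 1 - 31 * e) * h.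
  rewrite mulrA ler_wpM2r //.
  apply: (@le_trans _ _ ((2 * g + 1 - 40 * e) * (1 + 2 * e))).
    by rewrite ler_wpM2r //; lra.
  have : g * e <= 162 / 100 * e by rewrite ler_pM2r.
  have : 0 <= e ^+ 2 by rewrite sqr_ge0.
  lra.
split.
- have a20 : 0 < a ^+ 2 by rewrite exprn_gt0.
  rewrite -(ler_pM2l a20).
  have P1 : a * (a * h') <= a * (h + K) by rewrite ler_wpM2l // -lerBlDr.
  have P2 : a * (a * h'') <= a * (h' + K) by rewrite ler_wpM2l // -lerBlDr.
  have P3 : a ^+ 2 * K <= 263 / 100 * K by rewrite ler_wpM2r.
  have P4 : a * K <= 162 / 100 * K by rewrite ler_wpM2r.
  have P5 : (a + 1 + 2 * e) * h <= a ^+ 2 * (1 + 2 * e) * h by rewrite ler_wpM2r.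
  lra.
- apply: (le_trans G).
  have : (2 * g + 1 - 43 / 10 * e) * h <= (a + 1) * a * h by rewrite ler_wpM2r.
  lra.
apply: (le_trans G).
have C1 : a * (a - 1) * h - (a + 1) * K <= h' + h''.
  have : a * ((a - 1) * h - K) <= a * h' by rewrite ler_wpM2l.
  lra.
have C2 : (a + 1) * a * (a * (a - 1) * h - (a + 1) * K) <= (a + 1) * a * (h' + h'').
  by rewrite ler_wpM2l.
have C3 : (2 * g + 1 - 15 * e) * h <= (a + 1) * a * (a * (a - 1)) * h by rewrite ler_wpM2r.
have C4 : (a + 1) * a * ((a + 1) * K) <= 43 / 10 * (262 / 100 * K).
  apply: ler_pM => //; first by apply: mulr_ge0 => //; apply: addr_ge0.
  by rewrite ler_wpM2r //; lra.
lra.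
Qed.

(** * Four independent quartics *)

Definition qpoly (q : quad) : {poly int} := q.1.1%:P + q.1.2%:P * 'X + q.2%:P * 'X^2.

Lemma size_qpoly q : (size (qpoly q) <= 3)%N.
Proof.
rewrite /qpoly (leq_trans (size_polyD _ _)) // geq_max; apply/andP; split.
  rewrite (leq_trans (size_polyD _ _)) // geq_max (leq_trans (size_polyC_leq1 _)) //=.
  by rewrite mul_polyC (leq_trans (size_scale_leq _ _)) // size_polyX.
by rewrite mul_polyC (leq_trans (size_scale_leq _ _)) // size_polyXn.
Qed.

Lemma coef_qpoly_bound q j : (absz ((qpoly q)`_j)%R <= qht q)%N.
Proof.
have [h1 h2 h3] := absz_qht q.
rewrite /qpoly !coefD !coefCM coefC coefX coefXn.
by case: j => [|[|[|j]]] /=; rewrite ?mulr0 ?mulr1 ?addr0 ?add0r.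
Qed.

Definition rpoly (R : realType) (q : quad) : {poly R} :=
  (q.1.1%:~R)%:P + (q.1.2%:~R)%:P * 'X + (q.2%:~R)%:P * 'X^2.

Lemma map_qpoly (R : realType) q : map_poly intr (qpoly q) = rpoly R q.
Proof.
by rewrite /qpoly /rpoly !rmorphD /= !rmorphM /= !map_polyC /= ?map_polyXn ?map_polyX.
Qed.

Lemma horner_rpoly (R : realType) (z : R) q : (rpoly R q).[z] = qev z q.
Proof. by rewrite /rpoly /qev !(hornerD, hornerCM, hornerC, hornerX, hornerXn). Qed.

(** An explicit Bezout identity: eliminating T from the two quadratics leaves their resultant. *)
Lemma bezout_rpoly (R : realType) p q :
  exists U V : {poly R}, ((qres (qcross p q))%:~R)%:P = U * rpoly R q + V * rpoly R p.
Proof.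
pose w := qcross p q.
exists ((w.1.2%:~R)%:P * (p.2%:~R)%:P + (w.1.1%:~R)%:P * (p.1.2%:~R)%:P
        + (w.1.1%:~R)%:P * 'X * (p.2%:~R)%:P),
       (- ((w.1.2%:~R)%:P * (q.2%:~R)%:P + (w.1.1%:~R)%:P * (q.1.2%:~R)%:P
        + (w.1.1%:~R)%:P * 'X * (q.2%:~R)%:P)).
rewrite /w /qres /qcross /rpoly /= !(intrB, intrM, rmorphXn) /=.
by rewrite !(polyCB, polyCM, rmorphXn) /=; ring.
Qed.

Lemma size_rpoly (R : realType) q : q.2 != 0 -> size (rpoly R q) = 3%N.
Proof.
move=> a0; have sa : size ((q.2%:~R)%:P * 'X^2 : {poly R}) = 3%N.
  by rewrite mul_polyC size_scale ?intr_eq0 // size_polyXn.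
rewrite /rpoly addrC size_polyDl sa // (leq_ltn_trans (size_polyD _ _)) // gtn_max.
rewrite (leq_ltn_trans (size_polyC_leq1 _)) //=.
by rewrite mul_polyC (leq_ltn_trans (size_scale_leq _ _)) // size_polyX.
Qed.

Definition row_poly (Q Q' Q'' : quad) (k : 'I_4) : {poly int} :=
  if (k < 3)%N then 'X^k * qpoly Q else qpoly Q' * qpoly Q''.

Lemma size_row_poly Q Q' Q'' k : (size (row_poly Q Q' Q'' k) <= 5)%N.
Proof.
rewrite /row_poly; case: ifP => hk.
  apply: (leq_trans (size_polyMleq _ _)); rewrite size_polyXn.
  by have := size_qpoly Q; lia.
apply: (leq_trans (size_polyMleq _ _)).
by have := size_qpoly Q'; have := size_qpoly Q''; lia.
Qed.

Definition row_mat (Q Q' Q'' : quad) : 'M[int]_(4, 5) :=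
  \matrix_(k, j) (row_poly Q Q' Q'' k)`_j.

Lemma row_mat_horner (R : realType) (z : R) Q Q' Q'' k :
  \sum_j (row_mat Q Q' Q'' k j)%:~R * z ^+ j =
  if (k < 3)%N then z ^+ k * qev z Q else qev z Q' * qev z Q''.
Proof.
transitivity ((map_poly intr (row_poly Q Q' Q'' k)).[z] : R).
  rewrite (@horner_coef_wide _ 5) ?(leq_trans (size_poly _ _)) ?size_row_poly //.
  by apply: eq_bigr => j _; rewrite coef_map mxE.
rewrite /row_poly; case: ifP => _; rewrite rmorphM /= !map_qpoly hornerM !horner_rpoly //.
by rewrite map_polyXn hornerXn.
Qed.

Lemma row_mat_bound (R : realType) Q Q' Q'' k j (X : R) :
  (qht Q)%:R <= X -> 5 * (qht Q')%:R * (qht Q'')%:R <= X ->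
  `|row_mat Q Q' Q'' k j|%:~R <= X.
Proof.
move=> h1 h2; rewrite -natr_absz mxE /row_poly; case: ifP => hk.
  apply: le_trans h1; rewrite ler_nat mulrC coefMXn; case: ifP => // _.
  exact: coef_qpoly_bound.
apply: le_trans h2; rewrite -!natrM ler_nat coefM.
apply: (@leq_trans (\sum_(i < j.+1) (qht Q' * qht Q''))).
  elim/big_ind2: _ => // [x1 x2 y1 y2 l1 l2|i _].
    by apply: leq_trans (leq_add l1 l2); lia.
  by rewrite abszM leq_mul ?coef_qpoly_bound.
by rewrite sum_nat_const card_ord -mulnA leq_mul2r; have := ltn_ord j; lia.
Qed.

(** A linear relation has the form u Q + d Q' Q'' = 0 with u of degree at most 2 and d constant. The
    nonzero resultants make [Q] coprime to Q' and Q'', so the quadratic [Q] divides d; hence d = 0,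
    and then u = 0. *)
Lemma row_mat_independent (R : realType) Q Q' Q'' : Q.2 != 0 ->
  qres (qcross Q' Q) != 0 -> qres (qcross Q'' Q) != 0 ->
  forall c : 'rV[R]_4, c *m map_mx intr (row_mat Q Q' Q'') = 0 -> c = 0.
Proof.
move=> a0 r1 r2 c cM.
have [U [V E1]] := bezout_rpoly R Q' Q; have [U' [V' E2]] := bezout_rpoly R Q'' Q.
pose u : {poly R} := \poly_(i < 3) c 0 (inord i); set d := c 0 (inord 3).
have S : u * rpoly R Q + d%:P * (rpoly R Q' * rpoly R Q'') = 0.
  have -> : u * rpoly R Q + d%:P * (rpoly R Q' * rpoly R Q'') =
      \sum_(k < 4) (c 0 k)%:P * map_poly intr (row_poly Q Q' Q'' k).
    rewrite big_ord_recr /=; congr (_ + _ * _).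
    - rewrite /u poly_def mulr_suml; apply: eq_bigr => i _.
      rewrite /row_poly /= ltn_ord rmorphM /= map_polyXn map_qpoly mul_polyC -scalerAl.
      by congr (c 0 _ *: _); apply: val_inj; rewrite /= inordK // ltnS ltnW.
    - by congr (c 0 _)%:P; apply: val_inj; rewrite /= inordK.
    - by rewrite /row_poly /= rmorphM /= !map_qpoly.
  apply/polyP => j; rewrite coef0 coef_sum.
  case: (ltnP j 5) => hj.
    move/matrixP: cM => /(_ 0 (Ordinal hj)); rewrite !mxE => cM; rewrite -[RHS]cM.
    by apply: eq_bigr => k _; rewrite coefCM coef_map !mxE.
  apply: big1 => k _; rewrite coefCM coef_map /= nth_default ?mulr0 //.
  exact: leq_trans (size_row_poly _ _ _ _) hj.
have Q3 := size_rpoly R a0.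
have Q0 : rpoly R Q != 0 by rewrite -size_poly_gt0 Q3.
(* Substituting both Bezout identities and the relation [S] exhibits this constant as a multiple of
   [Q]; comparing degrees gives 0. *)
pose k : R := d * (qres (qcross Q' Q))%:~R * (qres (qcross Q'' Q))%:~R.
have kE : k%:P = (d%:P * (U * (U' * rpoly R Q + V' * rpoly R Q'') + V * rpoly R Q' * U')
     - V * V' * u) * rpoly R Q.
  have S' : d%:P * (rpoly R Q' * rpoly R Q'') = - (u * rpoly R Q).
    by apply/eqP; rewrite -addr_eq0 addrC S.
  rewrite /k !polyCM E1 E2.
  transitivity (d%:P * (U * (U' * rpoly R Q + V' * rpoly R Q'') + V * rpoly R Q' * U') * rpoly R Q
     + V * V' * (d%:P * (rpoly R Q' * rpoly R Q''))); first by ring.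
  by rewrite S'; ring.
have k0 : k = 0.
  apply: contrapT => /eqP k0; have := congr1 (fun p : {poly R} => size p) kE.
  set T := (X in X * _); rewrite size_polyC k0 /=; have [->|T0] := eqVneq T 0.
    by rewrite mul0r size_poly0.
  rewrite size_mul // Q3 addn3 /=; have := T0; rewrite -size_poly_gt0; lia.
have d0 : d = 0.
  move/eqP: k0; rewrite /k !mulf_eq0 !intr_eq0 (negPf r1) (negPf r2) !orbF.
  by move/eqP.
have u0 : u = 0.
  move/eqP: S; rewrite d0 mul0r addr0 mulf_eq0 (negPf Q0) orbF.
  by move/eqP.
apply/rowP => i; rewrite [RHS]mxE; case: (ltnP i 3) => hi.
  by have := congr1 (fun p : {poly R} => p`_i) u0; rewrite coef0 coef_poly hi inord_val.
rewrite -[RHS]d0 /d; congr (c 0 _); apply: val_inj; rewrite /= inordK //.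
by have := ltn_ord i; lia.
Qed.

Lemma le_powR_ln (R : realType) (y x r : R) : 0 < y -> ln y <= r * x -> y <= expR x `^ r.
Proof.
by move=> y0 h; rewrite -ler_ln ?posrE ?powR_gt0 ?expR_gt0 // ln_powR expRK.
Qed.

Lemma norm_exp_bound (R : realType) (z : R) (i : nat) : (i <= 4)%N -> `|z| ^+ i <= (1 + `|z|) ^+ 4.
Proof.
move=> i4; have z1 : 1 <= 1 + `|z| by rewrite lerDl.
apply: (@le_trans _ _ ((1 + `|z|) ^+ i)); last by rewrite ler_weXn2l.
by apply: lerXn2r; rewrite ?nnegrE ?addr_ge0 // lerDr.
Qed.

Lemma sqrt5_bounds (R : realType) : 22 / 10 <= Num.sqrt 5 :> R /\ Num.sqrt 5 <= 23 / 10 :> R.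
Proof.
have s5 : Num.sqrt 5 ^+ 2 = 5 :> R by rewrite sqr_sqrtr.
have s0 : 0 <= Num.sqrt 5 :> R by apply: sqrtr_ge0.
by split; nra.
Qed.

Lemma good_matrix (R : realType) (z : R) : transcendental z ->
  (((3 + Num.sqrt 5) / 2)%:E <= what_exp 2 z)%E ->
  forall d X0 : R, 0 < d -> exists (X : R) (M : 'M[int]_(4, 5)),
    [/\ X0 <= X, forall c : 'rV[R]_4, c *m map_mx intr M = 0 -> c = 0,
        forall k j, `|M k j|%:~R <= X
      & forall k, `|\sum_j (M k j)%:~R * z ^+ j| <= X `^ (- (2 + Num.sqrt 5 - d)) ].
Proof.
move=> tz W d X0 d0; have [s1 s2] := sqrt5_bounds R.
have [e [e0 [e1 He]]] := exponent_estimate d0.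
pose eta : R := (3 + Num.sqrt 5) / 2 - e.
have eta2 : 2 < eta by rewrite /eta; lra.
have U : quad_uniform z eta.
  have [|X1 [X11 HX]] := what_exp_gt W (_ : eta < _); first by rewrite /eta; lra.
  exists X1; split=> // X XX1; apply: poly_system_quad (HX _ XX1).
  by apply: le_trans XX1; apply: le_trans X11.
have [K1 [K10 HK]] := good_triple tz eta2 U.
have z1 : 1 <= 1 + `|z| by rewrite lerDl.
have Z1 : 1 <= (1 + `|z|) ^+ 4 by rewrite exprn_ege1.
have [Z ZE] : exists Z : R, Z = (1 + `|z|) ^+ 4 by eexists.
rewrite -ZE in Z1; have Z0 : 0 < Z by apply: lt_le_trans Z1.
have l5 : 0 <= ln 5 :> R by rewrite ln_ge0 ?ler1n.
have lZ : 0 <= ln Z by rewrite ln_ge0.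
(* ln 5 pays for the coefficients of Q' Q'', and ln Z for the powers of z in the shifted rows. *)
have [K KE] : exists K : R, K = K1 + ln 5 + ln Z by eexists.
have KK : K1 <= K by rewrite KE; lra.
have wk (u v : R) : u - K1 <= v -> u - K <= v by apply: le_trans; rewrite lerB.
have [A [A0 HA]] := He K (le_trans K10 KK).
have [Q [Q' [Q'' [[irQ Q'0 Q''0 c1 c2] [h [h' [h'' [[hE hE' hE'']]]]]]]]] :=
  HK (Num.max A (ln (Num.max 1 X0))).
move=> [+ h'0 h''0] [D1 D2] [U1 U2] [L1 L2 L3]; rewrite ge_max => /andP[Ah Xh].
have Q0 : Q != 0 by apply/negP => /quad0P[_ _ a0]; case: irQ; rewrite a0.
have Hp q : q != 0 -> (0 : R) < (qht q)%:R by move=> q0; rewrite ltr0n qht_gt0.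
have Lp q : q != 0 -> 0 < `|qev z q| by move=> q0; rewrite normr_gt0 qev_neq0.
have [R1 R2 R3] := HA _ _ _ _ _ _ Ah h'0 h''0 (wk _ _ D1) (wk _ _ D2) (wk _ _ U1)
  (wk _ _ U2) (wk _ _ L1) (wk _ _ L2) (wk _ _ L3).
set x : R := (1 + 2 * e) * h in R1 R2 R3.
have hx : h <= x by rewrite ler_peMl // ?(le_trans A0) // lerDl mulr_ge0 // ltW.
clear HA HK He D1 D2 U1 U2 L1 L2 L3 wk.
exists (expR x), (row_mat Q Q' Q''); split.
- apply: (@le_trans _ _ (Num.max 1 X0)); first by rewrite le_max lexx orbT.
  have m0 : 0 < Num.max 1 X0 by rewrite lt_max ltr01.
  by rewrite -ler_ln ?posrE ?expR_gt0 // expRK (le_trans Xh).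
- by apply: row_mat_independent; [case: irQ|apply: qres_cross_neq0|apply: qres_cross_neq0].
- move=> k j; apply: row_mat_bound.
    by rewrite -ler_ln ?posrE ?expR_gt0 ?Hp // expRK -hE.
  rewrite -ler_ln ?posrE ?expR_gt0 ?mulr_gt0 ?Hp // expRK !lnM_pos ?mulr_gt0 ?Hp //.
  by rewrite -hE' -hE''; lra.
move=> k; rewrite row_mat_horner; case: ifP => hk.
  rewrite normrM normrX; apply: (@le_trans _ _ (Z * `|qev z Q|)).
    by rewrite ler_wpM2r // ZE; exact: norm_exp_bound (ltnW (ltn_ord k)).
  apply: le_powR_ln; first by rewrite mulr_gt0 ?Lp.
  by rewrite lnM_pos ?Lp // mulNr; lra.
rewrite normrM; apply: le_powR_ln; first by rewrite mulr_gt0 ?Lp.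
by rewrite lnM_pos ?Lp // mulNr; lra.
Qed.

(** * The integer vector orthogonal to the four quartics *)

Lemma crossv_map (R : realType) m (M : 'M[int]_(m, m.+1)) j :
  crossv (map_mx intr M) j = (crossv M j)%:~R :> R.
Proof.
rewrite /crossv -cofactor_map_mx map_col_mx; congr (cofactor (col_mx _ _) _ _).
by apply/matrixP => a b; rewrite !mxE.
Qed.

(** The error exponent is 3 - g^3 + d: three rows of size [X] and one value at z. It is negative, so
    for large [X] a vanishing y_0 would leave integers y_j below 1 in size, against the independence
    of the rows. *)
Lemma good_cross (R : realType) (z : R) : transcendental z ->
  (((3 + Num.sqrt 5) / 2)%:E <= what_exp 2 z)%E ->
  exists C : R, 0 < C /\ forall d X0 : R, 0 < d -> d <= 1 ->
  exists (X : R) (M : 'M[int]_(4, 5)),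
    [/\ X0 <= X, crossv M 0 != 0 /\ `|crossv M 0|%:~R <= 24 * X ^+ 4,
        forall k j, `|M k j|%:~R <= X,
        forall k, `|\sum_j (M k j)%:~R * z ^+ j| <= X `^ (- (2 + Num.sqrt 5 - d))
      & forall i, `|(crossv M i)%:~R - z ^+ i * (crossv M 0)%:~R|
          <= C * X `^ (1 - Num.sqrt 5 + d) ].
Proof.
move=> tz W; have [s1 s2] := sqrt5_bounds R.
pose D : R := (1 + `|z|) ^+ 4.
have D1 : 1 <= D by rewrite exprn_ege1 // lerDl.
pose C : R := 4%:R * (24%:R * (2 * D)).
have C0 : 0 < C by rewrite !mulr_gt0 // (lt_le_trans ltr01).
exists C; split=> // d X0 d0 d1.
have [X1 [X11 HX1]] : exists X0 : R, 1 <= X0 /\ forall X, X0 <= X ->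
    C * X `^ (1 - Num.sqrt 5 + d) < X `^ 0 by apply: powR_absorb_lt; lra.
have [X [M [XX ind hM he]]] := good_matrix tz W (Num.max X0 X1) d0.
move: XX; rewrite ge_max => /andP[XX0 XX1].
have Xp : 0 < X by apply: lt_le_trans (le_trans X11 XX1).
have hMR i j : `|map_mx intr M i j| <= X by rewrite mxE -intr_norm.
have err i : `|(crossv M i)%:~R - z ^+ i * (crossv M 0)%:~R| <= C * X `^ (1 - Num.sqrt 5 + d).
  rewrite -!crossv_map.
  have -> : C * X `^ (1 - Num.sqrt 5 + d) =
      4%:R * (24%:R * (2 * D * X ^+ 3) * X `^ (- (2 + Num.sqrt 5 - d))).
    have -> : 1 - Num.sqrt 5 + d = 3%:R + (- (2 + Num.sqrt 5 - d)) by ring.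
    rewrite powRD; last by apply/implyP => _; rewrite gt_eqF.
    by rewrite powR_mulrn ?(ltW Xp) // /C; ring.
  apply: cross_error_bound => // [j|k]; first by apply: norm_exp_bound; rewrite -ltnS.
  by apply: le_trans (he k); under eq_bigr do rewrite mxE.
have y0 : crossv M 0 != 0.
  apply/eqP => y0; have [j yj] := cross_neq0 ind.
  move: yj; rewrite crossv_map intr_eq0 => yj.
  have := lt_le_trans (le_lt_trans (err j) (HX1 _ XX1)) (_ : X `^ 0 <= 1).
  rewrite powRr0 lexx y0 mulr0 subr0 => /(_ isT).
  by rewrite -intr_norm ltNge (ler_int R 1) -gtz0_ge1 normr_gt0 yj.
exists X, M; split=> //; split=> //.
by rewrite intr_norm -crossv_map; apply: cross_bound.
Qed.

Lemma lambda4_ge (R : realType) (z : R) : transcendental z ->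
  (((3 + Num.sqrt 5) / 2)%:E <= what_exp 2 z)%E ->
  (((Num.sqrt 5 - 1) / 4)%:E <= lambda_exp 4 z)%E.
Proof.
move=> tz W; have [s1 s2] := sqrt5_bounds R.
apply: le_ereal_sup_lt => eta eta_lt X0 /=.
have [C [C0 HC]] := good_cross tz W.
have e1 : 0 < 1 + `|eta| by rewrite ltr_wpDr.
(* Small enough for errors X^(1 - sqrt 5 + d) to beat the exponent eta at height X^(4 + d), where
   the extra d absorbs the constant 24. The absolute value allows for negative eta. *)
pose d : R := Num.min 1 ((Num.sqrt 5 - 1 - 4 * eta) / (2 * (1 + `|eta|))).
have d0 : 0 < d by rewrite lt_min ltr01 divr_gt0 ?mulr_gt0 //; lra.
have d1 : d <= 1 by rewrite ge_min lexx.
have dle : d * (2 * (1 + `|eta|)) <= Num.sqrt 5 - 1 - 4 * eta.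
  by rewrite -ler_pdivlMr ?mulr_gt0 // ge_min lexx orbT.
have ed : d * eta <= d * `|eta| by rewrite ler_pM2l // ler_norm.
have expo : 1 - Num.sqrt 5 + d < - (eta * (4 + d)) by lra.
have [X1 [X11 HX1]] := powR_absorb C expo.
have [X2 [X21 HX2]] : exists X0 : R, 1 <= X0 /\ forall X, X0 <= X ->
    24 * X `^ 4 <= X `^ (4 + d) by apply: powR_absorb; lra.
have [X [M [XX [y0 yX] _ _ err]]] := HC d (Num.max (Num.max 1 X0) (Num.max X1 X2)) d0 d1.
move: XX; rewrite !ge_max => /andP[/andP[XX XX0] /andP[XX1 XX2]].
have Xp : 0 < X by apply: lt_le_trans XX.
exists (X `^ (4 + d)); split.
  apply: (le_trans XX0); rewrite -[leLHS]powRr1 ?(ltW Xp) // ler_powR //; lra.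
apply/simult_systemP; exists (crossv M 0), (fun i => crossv M (lift 0 i)); split=> //.
  apply: (le_trans yX); rewrite -powR_mulrn ?(ltW Xp) //; exact: HX2.
move=> i; rewrite -powRrM -normrN opprB.
have -> : (4 + d) * - eta = - (eta * (4 + d)) by ring.
exact: le_trans (err (lift 0 i)) (HX1 _ XX1).
Qed.

(** Transference. With T = |y_0|, the pigeonhole gives a nonzero integer vector [v] of size about
    T^(1/4) with v . y = 0. The polynomial with coefficients [v] then has value at most about
    T^(1/4) E / T at z, and the bound on w_4 limits how small that can be. *)
Lemma simult_lower (R : realType) (z a k : R) : transcendental z ->
  (w_exp 4 z <= a%:E)%E -> (a - 3) / 4 < k -> 0 < k ->
  exists c : R, 0 < c /\ forall (y : 'I_5 -> int) (E : R), y 0 != 0 ->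
    (forall i, `|(y i)%:~R - z ^+ i * (y 0)%:~R| <= E) ->
    c * `|(y 0)%:~R| `^ (- k) <= E.
Proof.
move=> tz W ak k0; have ak' : a < 3 + 4 * k by lra.
have [X1 [X11 HX]] := w_exp_lt W ak'; clear W.
have X10 : 0 < X1 by apply: lt_le_trans X11.
pose D : R := (1 + `|z|) ^+ 4.
have D1 : 1 <= D by rewrite exprn_ege1 // lerDl.
(* For B > (40 D T)^(1/4), the pigeonhole bound 20 (2 D T) / B^4 is below 1, and the integer v . y
   vanishes. *)
pose G : R := (40 * D) `^ 4^-1.
have D40 : 1 <= 40 * D by lra.
have G1 : 1 <= G by rewrite -(powRr0 (40 * D)) ler_powR // invr_ge0.
pose C : R := 2 * G * X1.
have C1 : 1 <= C.
  have : 1 * 1 <= G * X1 by apply: ler_pM.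
  rewrite /C; lra.
have C0 : 0 < C by apply: lt_le_trans C1.
pose c : R := Num.min 1 (C `^ (- (4 + 4 * k)) / 5).
have c0 : 0 < c by rewrite lt_min ltr01 divr_gt0 ?powR_gt0.
exists c; split=> // y E y0 hE.
set T : R := `|(y 0)%:~R|.
have T1 : 1 <= T by rewrite /T -intr_norm (ler_int R 1) -gtz0_ge1 normr_gt0.
have T0 : 0 < T by apply: lt_le_trans T1.
have [E1|E1] := lerP 1 E.
  apply: le_trans E1; apply: (@le_trans _ _ (1 * 1)); last by rewrite mul1r.
  apply: ler_pM; rewrite ?(ltW c0) ?powR_ge0 //; first by rewrite ge_min lexx.
  by rewrite -[leRHS](powRr0 T) ler_powR // oppr_le0 ltW.
have yb i : `|(y i)%:~R : R| <= 2 * D * T.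
  have -> : (y i)%:~R = ((y i)%:~R - z ^+ i * (y 0)%:~R) + z ^+ i * (y 0)%:~R :> R by ring.
  apply: (le_trans (ler_normD _ _)); rewrite normrM normrX -/T.
  have h1 : `|z| ^+ i * T <= D * T.
    by rewrite ler_pM2r // norm_exp_bound // -ltnS.
  have h2 : 1 * 1 <= D * T by apply: ler_pM.
  have := hE i; lra.
pose t : R := G * T `^ 4^-1.
have T41 : 1 <= T `^ 4^-1 by rewrite -[X in X <= _](powRr0 T) ler_powR // invr_ge0.
have t1 : 1 <= t by rewrite -[leLHS]mulr1 ler_pM.
have t4 : t ^+ 4 = 40 * D * T.
  rewrite /t exprMn /G -!powR_mulrn ?powR_ge0 // -!powRrM mulVf //.
  by rewrite !powRr1 //; lra.
pose B := (Num.truncn t).+1.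
have tB : t < B%:R by apply: truncnS_gt.
have Bt : B%:R <= 2 * t.
  have t0 : 0 <= t by lra.
  have /andP[h _] := truncn_itv t0; rewrite /B -natr1; lra.
have B0 : (0 < B)%N by [].
have DT : 0 < 2 * D * T by rewrite !mulr_gt0 // (lt_le_trans ltr01 D1).
have [v [[i0 vi0] vB vs]] := small_linear_form DT B0 yb.
have vs0 : \sum_(i < 5) (v i)%:~R * (y i)%:~R = 0 :> R.
  have B4 : 40 * D * T < B%:R ^+ 4 by rewrite -t4 ltrXn2r //; lra.
  have : `|(\sum_(i < 5) v i * y i)%:~R| < 1 :> R.
    rewrite rmorph_sum /=; under eq_bigr do rewrite intrM.
    apply: (le_lt_trans vs); rewrite ltr_pdivrMr ?exprn_gt0 ?ltr0n // mul1r.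
    by apply: le_lt_trans B4; lra.
  rewrite -intr_norm ltNge (ler_int R 1) -gtz0_ge1 normr_gt0 negbK => /eqP S0.
  by rewrite -[RHS]/(0%:~R) -S0 rmorph_sum /=; apply: eq_bigr => i _; rewrite intrM.
pose X : R := C * T `^ 4^-1.
have X1' : X1 <= X.
  have : G * X1 <= G * X1 * T `^ 4^-1 by rewrite ler_peMr // mulr_ge0 // ltW // (lt_le_trans ltr01).
  have : 1 * X1 <= G * X1 by rewrite ler_pM2r.
  rewrite /X /C; lra.
have Xp : 0 < X by rewrite mulr_gt0 // powR_gt0.
have BX : B%:R <= X.
  apply: (le_trans Bt); rewrite /X /C /t.
  have : G * T `^ 4^-1 * 1 <= G * T `^ 4^-1 * X1 by rewrite ler_pM2l //; apply: lt_le_trans t1.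
  lra.
have vBR i : `|v i|%:~R <= B%:R :> R.
  by rewrite -[leRHS]/(B%:Z%:~R) ler_int.
have lf0 : lform z v != 0 by apply: transcendental_lform vi0.
have lfT : `|lform z v| * T <= 5 * (X * E).
  rewrite -normrM.
  have -> : lform z v * (y 0)%:~R = \sum_(i < 5) (v i)%:~R * (z ^+ i * (y 0)%:~R - (y i)%:~R).
    under [RHS]eq_bigr do rewrite mulrBr.
    by rewrite sumrB vs0 subr0 /lform mulr_suml; apply: eq_bigr => i _; rewrite mulrA.
  apply: (le_trans (ler_norm_sum _ _ _)).
  rewrite mulr_natl -[X in _ *+ X](card_ord 5) -sumr_const; apply: ler_sum => i _.
  rewrite normrM; apply: ler_pM => //.
    by rewrite -intr_norm; apply: le_trans BX.
  by rewrite distrC; apply: hE.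
have : X `^ (- (3 + 4 * k)) < `|lform z v|.
  rewrite ltNge; apply/negP => h; apply: (HX X X1'); apply/poly_systemP; first exact: ltW.
  by exists v; split=> // i; apply: le_trans BX.
rewrite -(ltr_pM2r T0) => /lt_le_trans-/(_ _ lfT) => H.
have H' : X `^ (- (4 + 4 * k)) * T <= 5 * E.
  rewrite -(ler_pM2l Xp); apply: le_trans (_ : 5 * (X * E) <= _); last by lra.
  apply: le_trans (ltW H); rewrite mulrA ler_pM2r //.
  rewrite -{1}[X]powRr1 ?(ltW Xp) // -powRD; last by apply/implyP => _; rewrite gt_eqF.
  by rewrite (_ : 1 - (4 + 4 * k) = - (3 + 4 * k)) //; ring.
have XE : X `^ (- (4 + 4 * k)) * T = C `^ (- (4 + 4 * k)) * T `^ (- k).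
  rewrite /X powRM ?powR_ge0 ?(ltW C0) // -powRrM -mulrA; congr (_ * _).
  rewrite -{2}[T]powRr1 ?(ltW T0) // -powRD; last by apply/implyP => _; rewrite gt_eqF.
  by congr (_ `^ _); field.
apply: (@le_trans _ _ (C `^ (- (4 + 4 * k)) / 5 * T `^ (- k))).
  by rewrite ler_wpM2r ?powR_ge0 // ge_min lexx orbT.
by move: H'; rewrite XE; lra.
Qed.

(** * Exponents in degree four *)

(** The errors of y are about X^(1 - sqrt 5), and those of a proportional [t] are |t_0| / |y_0|
    times as large. The lower bounds of [simult_lower] for y and for [t], with k close to (sqrt 5 -
    1) / 4, together keep |t_0| from falling much below X^4. *)
Lemma cross_multiple_lower (R : realType) (z : R) : transcendental z ->
  (((3 + Num.sqrt 5) / 2)%:E <= what_exp 2 z)%E ->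
  (w_exp 4 z <= (2 + Num.sqrt 5)%:E)%E ->
  forall rho X0 : R, 0 < rho -> rho <= 1 ->
  exists (X : R) (M : 'M[int]_(4, 5)),
    [/\ X0 <= X, crossv M 0 != 0 /\ `|crossv M 0|%:~R <= 24 * X ^+ 4,
        forall k j, `|M k j|%:~R <= X,
        forall k, `|\sum_j (M k j)%:~R * z ^+ j| <= X `^ (- 4)
      & forall i, `|(crossv M i)%:~R - z ^+ i * (crossv M 0)%:~R| <= X `^ (- 1) ] /\
    forall t : 'I_5 -> int, t 0 != 0 ->
      (forall i, crossv M 0 * t i = t 0 * crossv M i) ->
      X `^ (4 - rho) <= `|(t 0)%:~R|.
Proof.
move=> tz W2 W4 rho X0 r0 r1; have [s1 s2] := sqrt5_bounds R.
(* The exponent 4 - rho leaves room for this excess of k, for d = rho / 10, and for another rho / 10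
   which absorbs the constants through [L]. *)
pose k : R := (Num.sqrt 5 - 1) / 4 + rho / 40.
have k0 : 0 < k by rewrite /k; lra.
have [|c [c0 low]] := simult_lower tz W4 (_ : _ < k) k0; first by rewrite /k; lra.
have [C [C0 HC]] := good_cross tz W2; clear W2 W4.
pose d : R := rho / 10.
have d0 : 0 < d by rewrite /d; lra.
have d1 : d <= 1 by rewrite /d; lra.
have [X1 [X11 HX1]] : exists X0 : R, 1 <= X0 /\ forall X, X0 <= X ->
    C * X `^ (1 - Num.sqrt 5 + d) <= X `^ (- 1) by apply: powR_absorb; rewrite /d; lra.
pose L : R := (ln C - ln c) / (rho / 10).
have [X [M [XX [y0 yX] hM he err]]] :=
  HC d (Num.max (Num.max 1 X0) (Num.max X1 (expR L))) d0 d1.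
move: XX; rewrite !ge_max => /andP[/andP[X1' XX0] /andP[XX1 XL]].
have Xp : 0 < X by apply: lt_le_trans X1'.
exists X, M; split.
  split=> // [j|i]; last exact: le_trans (err i) (HX1 _ XX1).
  by apply: le_trans (he j) _; rewrite ler_powR // lerN2 /d; lra.
move=> t t0 ht.
set Y : R := `|(crossv M 0)%:~R|; set T : R := `|(t 0)%:~R|.
have Y0 : 0 < Y by rewrite normr_gt0 intr_eq0.
have T0 : 0 < T by rewrite normr_gt0 intr_eq0.
set Ey := C * X `^ (1 - Num.sqrt 5 + d) in err.
have Ey0 : 0 < Ey by rewrite mulr_gt0 // powR_gt0.
have ly := low (crossv M) Ey y0 err.
have lt := low t (T / Y * Ey) t0; rewrite -/Y in ly; rewrite -/T in lt.
have {}lt : c * T `^ (- k) <= T / Y * Ey.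
  apply: lt => i.
  have y0R : (crossv M 0)%:~R != 0 :> R by rewrite intr_eq0.
  have hR : (crossv M 0)%:~R * (t i)%:~R = (t 0)%:~R * (crossv M i)%:~R :> R.
    by rewrite -!intrM ht.
  have -> : (t i)%:~R - z ^+ i * (t 0)%:~R =
      (t 0)%:~R / (crossv M 0)%:~R * ((crossv M i)%:~R - z ^+ i * (crossv M 0)%:~R) :> R.
    apply: (mulfI y0R); rewrite mulrBr hR; field.
    by rewrite y0R.
  by rewrite normrM normf_div ler_wpM2l // divr_ge0.
have {}ly : ln c - k * ln Y <= ln Ey.
  move: ly => /(ln_le_pos (mulr_gt0 c0 (powR_gt0 _ Y0))).
  by rewrite lnM_pos ?powR_gt0 // ln_powR; lra.
have {}lt : ln c - k * ln T <= ln T - ln Y + ln Ey.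
  move: lt => /(ln_le_pos (mulr_gt0 c0 (powR_gt0 _ T0))).
  rewrite (lnM_pos (divr_gt0 T0 Y0) Ey0) (lnM_pos c0 (powR_gt0 _ T0)).
  by rewrite ln_div ?posrE // ln_powR; lra.
have EyE : ln Ey = ln C + (1 - Num.sqrt 5 + d) * ln X.
  by rewrite lnM_pos ?powR_gt0 // ln_powR.
have Lx : ln C - ln c <= rho / 10 * ln X.
  rewrite mulrC -ler_pdivrMr; last by lra.
  by rewrite -/L -[L]expRK ln_le_pos ?expR_gt0.
have x0 : 0 <= ln X by rewrite ln_ge0.
rewrite -ler_ln ?posrE ?powR_gt0 // ln_powR -(ler_pM2l k0).
(* The factor T / Y in the errors of [t] is eliminated by means of the lower bound for y itself. *)
have A : ln c - ln Ey <= k * ln T.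
  have k1 : 0 < 1 + k by lra.
  rewrite -(ler_pM2l k1).
  have : k * (ln c - k * ln T) <= k * (ln T - ln Y + ln Ey) by rewrite ler_pM2l.
  lra.
apply: le_trans A; rewrite EyE.
have B : k * (4 - rho) <= Num.sqrt 5 - 1 - d - rho / 10.
  have : 3 / 10 * rho <= k * rho by rewrite ler_pM2r // /k; lra.
  have : k * 4 = Num.sqrt 5 - 1 + rho / 10 by rewrite /k; field.
  rewrite /d; lra.
have : k * (4 - rho) * ln X <= (Num.sqrt 5 - 1 - d - rho / 10) * ln X by rewrite ler_wpM2r.
lra.
Qed.

Lemma lambda4_le (R : realType) (z : R) : transcendental z ->
  (w_exp 4 z <= (2 + Num.sqrt 5)%:E)%E ->
  (lambda_exp 4 z <= ((Num.sqrt 5 - 1) / 4)%:E)%E.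
Proof.
move=> tz W; have [s1 s2] := sqrt5_bounds R.
apply: ereal_sup_le_real => eta S; rewrite leNgt; apply/negP => hl.
pose k : R := (eta + (Num.sqrt 5 - 1) / 4) / 2.
have k0 : 0 < k by rewrite /k; lra.
have [|c [c0 low]] := simult_lower tz W (_ : _ < k) k0; first by rewrite /k; lra.
clear W; have ek : - eta < - k by rewrite ltrN2 /k; lra.
have [X1 [X11 HX1]] := powR_absorb_lt c^-1 ek.
have [X [XX1 /simult_systemP[x [y [x0 xX hy]]]]] := S X1.
pose v (i : 'I_5) : int := if unlift 0 i is Some j then y j else x.
have v0 : v 0 = x by rewrite /v unlift_none.
have X0 : 0 < X by apply: lt_le_trans (le_trans X11 XX1).
have := low v (X `^ (- eta)); rewrite v0 => /(_ x0).
have xR : (0 : R) < `|x%:~R| by rewrite normr_gt0 intr_eq0.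
move=> H; have : c * `|x%:~R| `^ (- k) <= X `^ (- eta).
  apply: H => i; case: (unliftP 0 i) => [j|] ->; last by rewrite v0 expr0 mul1r subrr normr0 powR_ge0.
  by rewrite /v liftK -normrN opprB; apply: hy.
have : X `^ (- k) <= `|x%:~R| `^ (- k).
  rewrite !powRN lef_pV2 ?posrE ?powR_gt0 //.
  by apply: ge0_ler_powR; rewrite ?nnegrE ?(ltW k0) ?(ltW X0) // -intr_norm.
rewrite -(ler_pM2l c0) => /le_trans h /h; rewrite -ler_pdivlMl // leNgt.
by rewrite HX1.
Qed.

Lemma what4_le (R : realType) (z : R) : transcendental z ->
  (((3 + Num.sqrt 5) / 2)%:E <= what_exp 2 z)%E ->
  (w_exp 4 z <= (2 + Num.sqrt 5)%:E)%E -> (what_exp 4 z <= 4%:E)%E.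
Proof.
move=> tz W2 W4; have [s1 s2] := sqrt5_bounds R.
apply: ereal_sup_le_real => eta [X0 S]; rewrite leNgt; apply/negP => hl.
have HX := cross_multiple_lower tz W2 W4; clear W2 W4.
have eta0 : 0 < eta by apply: lt_trans hl.
(* Then eta (1 - r) = (eta + 4) / 2 > 4: at height X^(1 - r) the value at z still outweighs y_0,
   which is at most 24 X^4. *)
pose r : R := (eta - 4) / (2 * eta).
have r0 : 0 < r by rewrite divr_gt0 ?mulr_gt0 // subr_gt0.
have rE : r * (2 * eta) = eta - 4 by rewrite /r mulfVK // gt_eqF // mulr_gt0.
have r2 : r <= 1 / 2 by rewrite ler_pdivrMr ?mulr_gt0 //; lra.
have [X1 [X11 HX1]] : exists X0 : R, 1 <= X0 /\ forall X, X0 <= X ->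
    48 * X `^ (4 - eta * (1 - r)) < X `^ 0 by apply: powR_absorb_lt; lra.
have [X2 [X21 HX2]] : exists X0 : R, 1 <= X0 /\ forall X, X0 <= X ->
    10 * X `^ (- r) < X `^ 0 by apply: powR_absorb_lt; lra.
have [X3 [X31 HX3]] : exists X0 : R, 1 <= X0 /\ forall X, X0 <= X ->
    120 * X `^ (4 - r) < X `^ (4 - r / 2) by apply: powR_absorb_lt; lra.
have r2' : 0 < r / 2 by lra.
have r2'' : r / 2 <= 1 by lra.
(* The square of max(1, X0) ensures X^(1 - r) >= X0, since r <= 1 / 2. *)
have [X [M [[XX [y0 yX] hM he err] mult]]] :=
  HX (r / 2) (Num.max (Num.max 1 ((Num.max 1 X0) `^ 2)) (Num.max X1 (Num.max X2 X3))) r2' r2''.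
clear HX; move: XX; rewrite !ge_max => /andP[/andP[X1' XX0] /andP[XX1 /andP[XX2 XX3]]].
have Xp : 0 < X by apply: lt_le_trans X1'.
have nz (u : R) : (u == 0) ==> (X != 0) by apply/implyP => _; rewrite gt_eqF.
have XS : X0 <= X `^ (1 - r).
  apply: (@le_trans _ _ (Num.max 1 X0)); first by rewrite le_max lexx orbT.
  have m0 : 0 <= Num.max 1 X0 by rewrite le_max ler01.
  apply: (@le_trans _ _ (X `^ 2^-1)); last by rewrite ler_powR //; lra.
  rewrite -[leLHS](powRr1 m0) -[X in _ `^ X](@mulfV _ (2 : R)) // powRrM.
  by apply: ge0_ler_powR; rewrite ?nnegrE ?invr_ge0 ?powR_ge0 ?(ltW Xp).
have X'p : 0 <= X `^ (1 - r) by apply: powR_ge0.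
have /(poly_systemP _ _ _ X'p)[v [vX v0 ve]] := S _ XS.
have vn : exists i, v i != 0.
  apply/existsP; apply: contraR v0; rewrite negb_exists => /forallP Z.
  apply/eqP; apply: big1 => i _; have := Z i; rewrite negbK => /eqP ->.
  by rewrite mul0r.
(* This integer splits into y_0 times the value at z and the errors of y weighted by the
   coefficients; each part is below 1 / 2. *)
have Py : \sum_j v j * crossv M j = 0.
  apply/eqP; rewrite -[_ == _]negbK -normr_gt0 gtz0_ge1 -(ler_int R) -ltNge intr_norm.
  have -> : (\sum_j v j * crossv M j)%:~R = (crossv M 0)%:~R * lform z v +
      \sum_j (v j)%:~R * ((crossv M j)%:~R - z ^+ j * (crossv M 0)%:~R) :> R.
    rewrite rmorph_sum /= /lform mulr_sumr -big_split /=; apply: eq_bigr => j _.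
    by rewrite intrM; ring.
  apply: (le_lt_trans (ler_normD _ _)).
  have B1 : `|(crossv M 0)%:~R * lform z v| < 1 / 2.
    rewrite normrM; apply: (@le_lt_trans _ _ (24 * X `^ (4 - eta * (1 - r)))).
      have -> : 24 * X `^ (4 - eta * (1 - r)) = 24 * X ^+ 4 * X `^ (1 - r) `^ (- eta).
        rewrite -mulrA; congr (_ * _); rewrite -powRrM -powR_mulrn ?(ltW Xp) // -powRD //.
        by congr (_ `^ _); ring.
      by apply: ler_pM => //; rewrite -intr_norm.
    by have := HX1 _ XX1; rewrite powRr0; lra.
  have B2 : `|\sum_j (v j)%:~R * ((crossv M j)%:~R - z ^+ j * (crossv M 0)%:~R)| < 1 / 2.
    apply: (@le_lt_trans _ _ (5 * X `^ (- r))); last by have := HX2 _ XX2; rewrite powRr0; lra.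
    apply: (le_trans (ler_norm_sum _ _ _)).
    rewrite mulr_natl -[X in _ *+ X](card_ord 5) -sumr_const; apply: ler_sum => j _.
    have -> : X `^ (- r) = X `^ (1 - r) * X `^ (- 1).
      by rewrite -powRD //; congr (_ `^ _); ring.
    by rewrite normrM; apply: ler_pM => //; rewrite -intr_norm.
  by lra.
(* The exchange yields size at most 120 X^(4 - r), with 120 = 5 times 4!, below the bound X^(4 - r /
   2) of [mult]. *)
have [t [t0 tp tb]] := orthogonal_exchange y0 Py vn hM vX.
have := mult t t0 tp; rewrite leNgt -intr_norm; case/negP.
apply: (le_lt_trans tb); apply: le_lt_trans (HX3 _ XX3).
have -> : X `^ (4 - r) = X `^ (1 - r) * X ^+ 3.
  by rewrite -powR_mulrn ?(ltW Xp) // -powRD //; congr (_ `^ _); ring.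
rewrite le_eqVlt; apply/orP; left; apply/eqP.
by rewrite (_ : 4`!%:R = 24) //; ring.
Qed.

Lemma lambdahat4_le (R : realType) (z : R) : transcendental z ->
  (((3 + Num.sqrt 5) / 2)%:E <= what_exp 2 z)%E ->
  (w_exp 4 z <= (2 + Num.sqrt 5)%:E)%E -> (lambdahat_exp 4 z <= (4^-1)%:E)%E.
Proof.
move=> tz W2 W4; have [s1 s2] := sqrt5_bounds R.
apply: ereal_sup_le_real => eta [X0 S]; rewrite leNgt; apply/negP => hl.
have HX := cross_multiple_lower tz W2 W4; clear W2 W4.
have eta0 : 0 < eta by apply: lt_trans hl; rewrite invr_gt0.
(* Then eta (4 - r) = (4 eta + 1) / 2 > 1: at height X^(4 - r) the errors still outweigh the entries
   of [M], of size at most [X]. *)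
pose r : R := (4 * eta - 1) / (2 * eta).
have r0 : 0 < r by rewrite divr_gt0 ?mulr_gt0 //; lra.
have rE : r * (2 * eta) = 4 * eta - 1 by rewrite /r mulfVK // gt_eqF // mulr_gt0.
have r2 : r <= 2 by rewrite ler_pdivrMr ?mulr_gt0 //; lra.
have [X1 [X11 HX1]] : exists X0 : R, 1 <= X0 /\ forall X, X0 <= X ->
    10 * X `^ (1 - eta * (4 - r)) < X `^ 0 by apply: powR_absorb_lt; lra.
have [X2 [X21 HX2]] : exists X0 : R, 1 <= X0 /\ forall X, X0 <= X ->
    2 * X `^ (- r) < X `^ 0 by apply: powR_absorb_lt; lra.
have [X3 [X31 HX3]] : exists X0 : R, 1 <= X0 /\ forall X, X0 <= X ->
    1 * X `^ (4 - r) < X `^ (4 - r / 2) by apply: powR_absorb_lt; lra.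
have r2' : 0 < r / 2 by lra.
have r2'' : r / 2 <= 1 by lra.
have [X [M [[XX [y0 yX] hM he err] mult]]] :=
  HX (r / 2) (Num.max (Num.max 1 X0) (Num.max X1 (Num.max X2 X3))) r2' r2''.
clear HX; move: XX; rewrite !ge_max => /andP[/andP[X1' XX0] /andP[XX1 /andP[XX2 XX3]]].
have Xp : 0 < X by apply: lt_le_trans X1'.
have nz (u : R) : (u == 0) ==> (X != 0) by apply/implyP => _; rewrite gt_eqF.
have XS : X0 <= X `^ (4 - r).
  apply: (le_trans XX0); rewrite -[leLHS]powRr1 ?(ltW Xp) // ler_powR //; lra.
have /simult_systemP[x [y [x0 xX hy]]] := S _ XS.
pose v (i : 'I_5) : int := if unlift 0 i is Some j then y j else x.
have v0 : v 0 = x by rewrite /v unlift_none.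
have ev i : `|(v i)%:~R - z ^+ i * x%:~R| <= X `^ (4 - r) `^ (- eta).
  case: (unliftP 0 i) => [j|] ->; last by rewrite v0 expr0 mul1r subrr normr0 powR_ge0.
  by rewrite /v liftK -normrN opprB; apply: hy.
have Mv k : \sum_j M k j * v j = 0.
  apply/eqP; rewrite -[_ == _]negbK -normr_gt0 gtz0_ge1 -(ler_int R) -ltNge intr_norm.
  have -> : (\sum_j M k j * v j)%:~R = x%:~R * (\sum_j (M k j)%:~R * z ^+ j) +
      \sum_j (M k j)%:~R * ((v j)%:~R - z ^+ j * x%:~R) :> R.
    rewrite rmorph_sum /= mulr_sumr -big_split /=; apply: eq_bigr => j _.
    by rewrite intrM; ring.
  apply: (le_lt_trans (ler_normD _ _)).
  have B1 : `|x%:~R * (\sum_j (M k j)%:~R * z ^+ j)| < 1 / 2.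
    rewrite normrM; apply: (@le_lt_trans _ _ (X `^ (- r))).
      have -> : X `^ (- r) = X `^ (4 - r) * X `^ (- 4).
        by rewrite -powRD //; congr (_ `^ _); ring.
      by apply: ler_pM => //; rewrite -intr_norm.
    by have := HX2 _ XX2; rewrite powRr0; lra.
  have B2 : `|\sum_j (M k j)%:~R * ((v j)%:~R - z ^+ j * x%:~R)| < 1 / 2.
    apply: (@le_lt_trans _ _ (5 * X `^ (1 - eta * (4 - r)))); last by have := HX1 _ XX1; rewrite powRr0; lra.
    apply: (le_trans (ler_norm_sum _ _ _)).
    rewrite mulr_natl -[X in _ *+ X](card_ord 5) -sumr_const; apply: ler_sum => j _.
    have -> : X `^ (1 - eta * (4 - r)) = X * X `^ (4 - r) `^ (- eta).
      rewrite -powRrM -{2}[X]powRr1 ?(ltW Xp) // -powRD //; congr (_ `^ _); ring.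
    by rewrite normrM; apply: ler_pM => //; rewrite -intr_norm.
  by lra.
have := mult v _ (kernel_proportional y0 Mv); rewrite v0 => /(_ x0).
rewrite leNgt -intr_norm; case/negP; apply: (le_lt_trans xX).
by have := HX3 _ XX3; rewrite mul1r.
Qed.


(** * Lower bounds for the uniform exponents from the pigeonhole principle *)

Lemma truncn_ge_half (R : realType) (x : R) : 1 <= x -> x / 2 <= (Num.truncn x)%:R.
Proof.
move=> x1; have := truncnS_gt x; rewrite -natr1.
have : 1 <= (Num.truncn x)%:R :> R by rewrite ler1n truncn_gt0.
lra.
Qed.

Lemma what4_ge (R : realType) (z : R) : transcendental z -> (4%:E <= what_exp 4 z)%E.
Proof.
move=> tz; apply: le_ereal_sup_lt => eta eta4 /=.
pose D : R := (1 + `|z|) ^+ 4.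
have D0 : 0 < D by rewrite exprn_gt0 // ltr_wpDr.
have N4 : - 4 < - eta by rewrite ltrN2.
(* 320 is 4 times 5 times 2^4; the last factor arises because the integral part of [X] is at least X
   / 2. *)
have [X1 [X11 HX1]] := powR_absorb (320 * D) N4.
exists X1 => X XX1; have X1' : 1 <= X := le_trans X11 XX1.
have Xp : 0 < X by apply: lt_le_trans X1'.
have Bp : (0 < Num.truncn X)%N by rewrite truncn_gt0.
have zD (i : 'I_5) : `|z ^+ i| <= D by rewrite normrX norm_exp_bound // -ltnS.
have [v [[i vi] vB vs]] := small_linear_form D0 Bp zD.
apply/poly_systemP; first exact: ltW.
exists v; split.
- move=> j; apply: (@le_trans _ _ (Num.truncn X)%:R); last by rewrite truncn_le ltW.
  by rewrite -[leRHS]/((Num.truncn X)%:Z%:~R) ler_int.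
- exact: transcendental_lform vi.
apply: (le_trans vs); apply: le_trans (HX1 _ XX1).
have -> : X `^ (- 4) = X ^- 4 by rewrite powRN powR_mulrn ?(ltW Xp).
have -> : 320 * D * X ^- 4 = 4 * 5 * D * (X / 2) ^- 4 by field; rewrite gt_eqF.
rewrite ler_pM2l ?mulr_gt0 // lef_pV2 ?posrE ?exprn_gt0 ?divr_gt0 ?ltr0n //.
by apply: lerXn2r; rewrite ?nnegrE ?divr_ge0 ?(ltW Xp) // truncn_ge_half.
Qed.

Lemma lambdahat4_ge (R : realType) (z : R) : ((4^-1)%:E <= lambdahat_exp 4 z)%E.
Proof.
apply: le_ereal_sup_lt => eta eta4 /=.
have N4 : - 4^-1 < - eta by rewrite ltrN2.
(* The factor 2 pays for replacing X^(1/4) by its integral part. *)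
have [X1 [X11 HX1]] := powR_absorb 2 N4.
exists X1 => X XX1; have X1' : 1 <= X := le_trans X11 XX1.
have Xp : 0 < X by apply: lt_le_trans X1'.
pose t : R := X `^ 4^-1; have t0 : 0 < t by rewrite powR_gt0.
have t1 : 1 <= t by rewrite /t -[X in X <= _](powRr0 X) ler_powR // invr_ge0.
have Np : (0 < Num.truncn t)%N by rewrite truncn_gt0.
have [x [y [x0 xN hy]]] := dirichlet_simultaneous (fun i : 'I_4 => z ^+ i.+1) Np.
apply/simult_systemP; exists x, y; split=> //.
  apply: (@le_trans _ _ ((Num.truncn t ^ 4)%:Z%:~R)); first by rewrite ler_int.
  rewrite -[leLHS]/((Num.truncn t ^ 4)%:R) natrX.
  have -> : X = t ^+ 4 by rewrite /t -powR_mulrn ?powR_ge0 // -powRrM mulVf // powRr1 // ltW.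
  by apply: lerXn2r; rewrite ?nnegrE ?(ltW t0) // truncn_le ltW.
move=> i; apply: (le_trans (hy i)); apply: le_trans (HX1 _ XX1).
rewrite powRN -/t -[leRHS]invrK invfM invrK lef_pV2 ?posrE ?mulr_gt0 ?invr_gt0 ?ltr0n //.
by rewrite mulrC truncn_ge_half.
Qed.

Unset Implicit Arguments.

Theorem theorem2p3 (R : realType) (zeta : R) (hzeta : extremal_number zeta) :
  (((Num.sqrt 5 - 1) / 4)%:E <= lambda_exp 4 zeta)%E
  /\ (w_exp 4 zeta = w_exp 2 zeta /\ w_exp 2 zeta = (2 + Num.sqrt 5)%:E ->
      [/\ lambda_exp 4 zeta = ((Num.sqrt 5 - 1) / 4)%:E,
          what_exp 4 zeta = 4%:E
        & lambdahat_exp 4 zeta = (4^-1)%:E]).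
Proof.
move: hzeta => [tz W]; have W2 : (((3 + Num.sqrt 5) / 2)%:E <= what_exp 2 zeta)%E by rewrite W.
split; first exact: lambda4_ge.
move=> [E4 E2]; have W4 : (w_exp 4 zeta <= (2 + Num.sqrt 5)%:E)%E by rewrite E4 E2.
split; apply/eqP; rewrite eq_le; apply/andP; split.
- exact: lambda4_le.
- exact: lambda4_ge.
- exact: what4_le.
- exact: what4_ge.
- exact: lambdahat4_le.
- exact: lambdahat4_ge.
Qed.
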